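(* Both the edit distance $\delta_{\mathrm E}$ and the one-degree edit distance $\delta_1$ are metrics on the set of all abstract merge trees (where abstract merge trees are identified if they are isomorphic as rooted edge-labeled trees).
   Context: Rooted trees $T$ are directed graphs with vertex set $V(T)$, edge set $E(T)\subseteq V(T)\times V(T)$ and a unique root $\mathrm{root}(T)$, whose edges point from child to parent: $(c,p)\in E(T)$ means that $c$ is a child of $p$ and $p$ is the parent of $c$. $\deg_T(p)$ is the number of children of $p$. A leaf is a node without children. An abstract merge tree is an unordered rooted tree $T$ (of in general arbitrary degree) with edge labels $\ell:E(T)\to\mathbb R_{>0}$ such that $\deg_T(\mathrm{root}(T))=1$ and $\deg_T(v)\neq 1$ for all $v\in V(T)$ with $v\neq\mathrm{root}(T)$. Edit operations. The following operations transform an abstract merge tree $T,\ell$ into another abstract merge tree $T',\ell'$: (1) Edge relabel: change the length of an edge $(c,p)$ to a new value $v\in\mathbb R_{>0}$, i.e. $T'=T$, $\ell'((c,p))=v$ and $\ell'(e)=\ell(e)$ for all $e\neq(c,p)$. (2) Edge contraction (also called deletion): remove an edge from the tree and merge the two nodes; then remove the parent node if it had only two children originally. Formally, for a node $p$ with children $c_0,\dots,c_k$ and parent $p'$, the tree $T'$ after contracting $(c_i,p)$ is defined as follows. If $k>1$, then $$V(T')=V(T)\setminus\{c_i\},\qquad E(T')=E(T)\setminus\{(c_i,p)\},$$ and $\ell'=\ell$ (on the remaining edges). If $k=1$, then $$V(T')=V(T)\setminus\{c_i,p\},\qquad E(T')=(E(T)\cup\{(c_{1-i},p')\})\setminus\{(c_i,p),(c_{1-i},p),(p,p')\},$$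 $\ell'((c_{1-i},p'))=\ell((p,p'))+\ell((c_{1-i},p))$, and $\ell'(e)=\ell(e)$ for all $e\neq(c_{1-i},p')$. (3) Inverse edge contraction (also called insertion): the inverse operation to edge contraction. Costs. With $0$ as blank symbol, the cost function is $\mathrm c(l_1,l_2)=|l_1-l_2|$ for $l_1,l_2\in\mathbb R_{\ge 0}$: a relabel of an edge from label $l_1$ to label $l_2$ costs $|l_1-l_2|$, and a deletion or insertion of an edge costs the label of that edge. For a sequence $S$ of edit operations, $\mathrm c(S)$ is the sum of the costs of its operations, and $T_1\xrightarrow{S}T_2$ means that $S$ transforms $T_1$ into $T_2$. $S$ is called one-degree if all its insertions and deletions happen on edges connecting a leaf node. Define $$\delta_{\mathrm E}(T_1,T_2)=\min\{\mathrm c(S)\mid T_1\xrightarrow{S}T_2\},\qquad \delta_1(T_1,T_2)=\min\{\mathrm c(S)\mid T_1\xrightarrow{S}T_2,\ S\text{ is one-degree}\}.$$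
   Formalization: When the child c of a contracted edge (c,p) is not a leaf, the displayed formulas leave edges to the removed node c; here the children of c become children of p, and p is then kept, even if it had only two children. Leaf contractions are as displayed. *)

(* Defs.v *)
From HB Require Import structures.
From mathcomp Require Import all_boot all_order all_algebra finmap.
From mathcomp Require Import boolp classical_sets reals.

Set Implicit Arguments.
Unset Strict Implicit.
Unset Printing Implicit Defensive.

Import Order.TTheory GRing.Theory Num.Theory.

Local Open Scope fset_scope.
Local Open Scope ring_scope.

(* Vertices are drawn from nat; as trees are only considered up to isomorphism
   this covers all finite trees.  An edge is a pair (child, parent). *)
Definition edge : Type := (nat * nat)%type.

Section Graphs.
Variables (V : {fset nat}) (E : {fset edge}).

Definition children (p : nat) : {fset nat} := [fset x in V | (x, p) \in E].
Definition deg (p : nat) : nat := #|` children p|.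
Definition leaf (v : nat) : bool := deg v == 0%N.

Definition rooted_tree (r : nat) : Prop :=
  [/\ r \in V,
      forall c p, (c, p) \in E -> c \in V /\ p \in V,
      forall p, (r, p) \notin E,
      forall c, c \in V -> c != r -> exists! p, (c, p) \in E
    & forall v, v \in V ->
        exists2 s, path (fun c p => (c, p) \in E) v s & last v s = r].
End Graphs.

(* Values of [len] outside [edges] are irrelevant: no notion below depends on them. *)
Record merge_tree (R : realType) := MergeTree {
  verts : {fset nat};
  edges : {fset edge};
  root : nat;
  len : edge -> R;
  _ : rooted_tree verts edges root;
  _ : deg verts edges root = 1%N;
  _ : forall v, v \in verts -> v != root -> deg verts edges v <> 1%N;
  _ : forall e, e \in edges -> 0 < len e
}.

Section EditDistance.
Variable R : realType.
Implicit Types (T : merge_tree R) (e : edge) (c p : nat).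

Definition isom T T' : Prop :=
  exists f : nat -> nat,
    [/\ {in verts T &, injective f},
        verts T' = [fset f x | x in verts T],
        root T' = f (root T),
        {in verts T &, forall x y, ((f x, f y) \in edges T') = ((x, y) \in edges T)}
      & forall x y, (x, y) \in edges T -> len T' (f x, f y) = len T (x, y)].

Definition relabels e (v : R) T T' : Prop :=
  [/\ e \in edges T,
      [/\ verts T' = verts T, edges T' = edges T & root T' = root T],
      len T' e = v
    & forall e', e' \in edges T -> e' != e -> len T' e' = len T e'].

Definition reparent c p e : edge := if e.2 == c then (e.1, p) else e.

(* Contraction of (c, p) when p still has at least two children after c has
   been merged into p: the children of c become children of p.  If c is a leaf,
   [reparent c p] is the identity on edges T. *)
Definition contracts_merge c p T T' : Prop :=
  [/\ (c, p) \in edges T, p != root T,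
      (2 < deg (verts T) (edges T) p)%N || ~~ leaf (verts T) (edges T) c,
      [/\ verts T' = verts T `\ c,
          edges T' = [fset reparent c p e | e in edges T `\ (c, p)]
        & root T' = root T]
    & forall e, e \in edges T `\ (c, p) -> len T' (reparent c p e) = len T e].

(* Contraction of (c, p) when c is a leaf with a single sibling d: p would be
   left with only the child d, so it is removed as well. *)
Definition contracts_prune c p T T' : Prop :=
  exists d p' : nat,
  [/\ [/\ (c, p) \in edges T, leaf (verts T) (edges T) c & (p, p') \in edges T],
      [/\ (d, p) \in edges T, d != c & deg (verts T) (edges T) p = 2%N],
      [/\ verts T' = verts T `\` [fset c; p],
          edges T' = ((d, p') |` edges T) `\` [fset (c, p); (d, p); (p, p')]
        & root T' = root T],
      len T' (d, p') = len T (p, p') + len T (d, p)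
    & forall e, e \in edges T' -> e != (d, p') -> len T' e = len T e].

Definition contracts e T T' : Prop :=
  contracts_merge e.1 e.2 T T' \/ contracts_prune e.1 e.2 T T'.

Variant edit_op :=
  | Relabel of edge & R
  | Contract of edge
  | Insert of edge.

(* For [Insert e], e is an edge of the resulting tree T'. *)
Definition applies (o : edit_op) T T' : Prop :=
  match o with
  | Relabel e v => relabels e v T T'
  | Contract e => contracts e T T'
  | Insert e => contracts e T' T
  end.

Record edit_step := EditStep {
  before : merge_tree R;
  op : edit_op;
  after : merge_tree R;
  _ : applies op before after
}.

Definition cost (l1 l2 : R) : R := `|l1 - l2|.

Definition step_cost (s : edit_step) : R :=
  match op s with
  | Relabel e v => cost (len (before s) e) v
  | Contract e => cost (len (before s) e) 0
  | Insert e => cost 0 (len (after s) e)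
  end.

Definition step_one_degree (s : edit_step) : bool :=
  match op s with
  | Relabel _ _ => true
  | Contract e => leaf (verts (before s)) (edges (before s)) e.1
  | Insert e => leaf (verts (after s)) (edges (after s)) e.1
  end.

Definition seq_cost (S : seq edit_step) : R := \sum_(s <- S) step_cost s.

Definition one_degree (S : seq edit_step) : bool := all step_one_degree S.

(* Consecutive trees are identified up to isomorphism. *)
Fixpoint transforms T1 (S : seq edit_step) T2 : Prop :=
  match S with
  | [::] => isom T1 T2
  | s :: S' => isom T1 (before s) /\ transforms (after s) S' T2
  end.

Definition is_min (A : set R) (m : R) : Prop := A m /\ lbound A m.

(* The least element of A, and 0 if there is none.  The fallback is harmless
   below: a distance that vanishes only on isomorphic trees (for which the empty
   sequence attains 0) cannot have used it, so the metric axioms for the two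
   distances entail that all the minima exist. *)
Definition set_min (A : set R) : R := xget 0 (is_min A).

Definition delta_E T1 T2 : R :=
  set_min (fun x => exists2 S, transforms T1 S T2 & seq_cost S = x).

Definition delta_1 T1 T2 : R :=
  set_min (fun x =>
    exists2 S, transforms T1 S T2 /\ one_degree S & seq_cost S = x).

(* d induces a metric on isomorphism classes of abstract merge trees. *)
Definition is_metric_up_to_isom (d : merge_tree R -> merge_tree R -> R) : Prop :=
  [/\ forall T1 T1' T2 T2', isom T1 T1' -> isom T2 T2' -> d T1 T2 = d T1' T2',
      forall T1 T2, 0 <= d T1 T2,
      forall T1 T2, d T1 T2 = 0 <-> isom T1 T2,
      forall T1 T2, d T1 T2 = d T2 T1
    & forall T1 T2 T3, d T1 T3 <= d T1 T2 + d T2 T3].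

End EditDistance.

(* Main.v *)
(* Fix trees T and U. Choose a set K of labels and injections s, t of K into the
   leaves of T and of U. Each edge of T has a mask, the set of labels of the
   selected leaves below it; let P_T(A) be the total length of the edges of T
   with mask A. Deleting all unselected leaves of T costs exactly P_T(set0), in
   any order, because pruning only adds up lengths of edges with equal masks, and
   it leaves a tree whose edges have lengths P_T(A). The selection thus has cost
     P_T(set0) + P_U(set0) + sum_(A != set0) |P_T(A) - P_U(A)|,
   the price of deleting, relabelling and inserting; in the one-degree case the
   supports of P_T and P_U away from set0 must agree, as inner edges cannot be
   contracted. Conversely, one edit operation from T to T' changes the cheapest
   selection between T and U by at most the cost of the operation, so no edit
   sequence beats the cheapest selection. As there are finitely many selections,
   both minima exist, and the metric axioms follow by concatenating and reversing
   sequences. *)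
From mathcomp Require Import all_boot all_order all_algebra.
From mathcomp Require Import boolp classical_sets reals.
From mathcomp Require Import finmap.
From mathcomp Require Import lra.
Require Import Defs.

Set Implicit Arguments.
Unset Strict Implicit.
Unset Printing Implicit Defensive.

Import Order.TTheory GRing.Theory Num.Theory.

Local Open Scope fset_scope.
Local Open Scope ring_scope.

(** * The descendant order *)

(** Edges point to the parent, so [y] is an ancestor of [x] or [x] itself. The relation is boolean,
    by classical reflection, so that it can cut out finite sets such as [mask]. *)
Definition below (E : {fset edge}) (x y : nat) : bool :=
  `[< exists2 s, path (fun c p => (c, p) \in E) x s & last x s = y >].

Lemma below_refl E x : below E x x.
Proof. by apply/asboolP; exists [::]. Qed.

Lemma below_edge E x y z : (x, y) \in E -> below E y z -> below E x z.
Proof.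
move=> xy /asboolP[s ps ls]; apply/asboolP; exists (y :: s) => //=.
by rewrite xy.
Qed.

Lemma edge_below E x y : (x, y) \in E -> below E x y.
Proof. by move=> xy; apply: below_edge xy (below_refl _ _). Qed.

Lemma belowP E x z : below E x z -> x = z \/ exists2 y, (x, y) \in E & below E y z.
Proof.
move=> /asboolP[[|y s] /= ps ls]; first by left.
by case/andP: ps => xy ps; right; exists y => //; apply/asboolP; exists s.
Qed.

Lemma below_trans E x y z : below E x y -> below E y z -> below E x z.
Proof.
move=> /asboolP[s ps ls] /asboolP[s' ps' ls']; apply/asboolP.
by exists (s ++ s'); rewrite ?cat_path ?last_cat ls // ps.
Qed.

Lemma below_sub E E' x y :
  (forall u v, (u, v) \in E -> below E' u v) -> below E x y -> below E' x y.
Proof.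
move=> sEE' /asboolP[s]; elim: s x => [|u s IHs] x /=.
  by move=> _ <-; apply: below_refl.
by case/andP=> /sEE' xu ps ls; apply: below_trans xu (IHs _ ps ls).
Qed.

(** * Rooted trees: parents, acyclicity, leaves *)

Section Trees.
Variable R : realType.
Implicit Types T U : merge_tree R.

Lemma treeP T : rooted_tree (verts T) (edges T) (root T).
Proof. by case: T. Qed.

Lemma root_verts T : root T \in verts T.
Proof. by case: (treeP T). Qed.

Lemma edge_verts T c p : (c, p) \in edges T -> c \in verts T /\ p \in verts T.
Proof. by case: (treeP T) => _ + _ _ _; apply. Qed.

Lemma edge_neq_root T c p : (c, p) \in edges T -> c != root T.
Proof.
case: (treeP T) => _ _ nr _ _ cp; apply/eqP => cr.
by have := nr p; rewrite -cr cp.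
Qed.

Lemma edge_fun T c p q : (c, p) \in edges T -> (c, q) \in edges T -> p = q.
Proof.
move=> cp cq; case: (treeP T) => _ _ _ par _.
have [p0 [_ u]] := par c (edge_verts cp).1 (edge_neq_root cp).
by rewrite -(u _ cp) -(u _ cq).
Qed.

Lemma deg_root T : deg (verts T) (edges T) (root T) = 1%N.
Proof. by case: T. Qed.

Lemma deg_neq1 T v : v \in verts T -> v != root T ->
  deg (verts T) (edges T) v <> 1%N.
Proof. by case: T v. Qed.

Lemma len_gt0 T e : e \in edges T -> 0 < len T e.
Proof. by case: T e. Qed.

Definition parent T (v : nat) : nat := xget 0%N (fun p => (v, p) \in edges T).

Lemma parentP T v : v \in verts T -> v != root T -> (v, parent T v) \in edges T.
Proof.
move=> vV vr; case: (treeP T) => _ _ _ par _.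
have [p [vp _]] := par v vV vr.
by rewrite /parent; case: xgetP => [q _ //|/(_ p)].
Qed.

Lemma parentE T v p : (v, p) \in edges T -> parent T v = p.
Proof.
move=> vp; have [vV _] := edge_verts vp.
exact: edge_fun (parentP vV (edge_neq_root vp)) vp.
Qed.

(** Induction from the root down to the children, obtained from the length of a path to the root. *)
Lemma tree_ind T (P : nat -> Prop) :
  P (root T) -> (forall c p, (c, p) \in edges T -> P p -> P c) ->
  forall v, v \in verts T -> P v.
Proof.
move=> Pr Pe v vV; case: (treeP T) => _ _ _ _ /(_ v vV)[s].
elim: s v {vV} => [|u s IHs] v /=; first by move=> _ ->.
by case/andP=> vu ps ls; apply: Pe vu (IHs _ ps ls).
Qed.

Lemma below_root T v : v \in verts T -> below (edges T) v (root T).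
Proof.
by elim/(@tree_ind T): v / => [|c p cp]; [apply: below_refl | apply: below_edge].
Qed.

Lemma root_below T v : below (edges T) (root T) v -> v = root T.
Proof. by move=> /belowP[//|[y /edge_neq_root]]; rewrite eqxx. Qed.

(** Acyclicity: a cycle through a vertex also runs through its parent, so induction from the root,
    which has no outgoing edge, excludes it. *)
Lemma edge_nbelow T x p : (x, p) \in edges T -> ~~ below (edges T) p x.
Proof.
move=> xp; have [xV _] := edge_verts xp; move: p xp.
elim/(@tree_ind T): x / xV => [p /edge_neq_root|c q cq IHq p cp].
  by rewrite eqxx.
rewrite (edge_fun cp cq); apply/negP => /belowP[qc|[q' qq' q'c]].
  by move: cq (IHq q); rewrite -qc => cq /(_ cq); rewrite below_refl.
by move: (IHq _ qq'); rewrite (below_trans q'c (edge_below cq)).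
Qed.

Lemma below_anti T x y : below (edges T) x y -> below (edges T) y x -> x = y.
Proof.
move=> /belowP[//|[p xp py]] yx.
by move: (edge_nbelow xp); rewrite (below_trans py yx).
Qed.

Lemma edge_neq T x p : (x, p) \in edges T -> x != p.
Proof. by move=> xp; apply: contraNneq (edge_nbelow xp) => ->; apply: below_refl. Qed.

Lemma lt_parent T x p y : (x, p) \in edges T -> below (edges T) x y -> y != x ->
  below (edges T) p y.
Proof.
by move=> xp /belowP[->|[q xq qy _]]; [rewrite eqxx | rewrite (edge_fun xp xq)].
Qed.

Lemma below_vertsl T x y : below (edges T) x y -> y \in verts T -> x \in verts T.
Proof. by move=> /belowP[->//|[z /edge_verts[]]]. Qed.

(** Parents are unique, so two upward paths from [x] agree as long as both last: the ancestors of a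
    vertex form a chain. *)
Lemma below_comparable T x y z : below (edges T) x y -> below (edges T) x z ->
  below (edges T) y z || below (edges T) z y.
Proof.
move=> /asboolP[s]; elim: s x => [|u s IHs] x /=; first by move=> _ -> ->.
case/andP=> xu ps ls /belowP[<-|[w xw wz]].
  by rewrite (below_edge xu) ?orbT //; apply/asboolP; exists s.
by apply: IHs ps ls _; rewrite (edge_fun xu xw).
Qed.

(** Two siblings above [x] would be comparable; then their parent would lie below the upper one,
    against acyclicity. *)
Lemma siblings_disjoint T c c' p x : (c, p) \in edges T -> (c', p) \in edges T ->
  below (edges T) x c -> below (edges T) x c' -> c = c'.
Proof.
have sub a b : (a, p) \in edges T -> (b, p) \in edges T ->
    below (edges T) a b -> a = b.
  move=> ap bp ab; apply/eqP/negPn/negP; rewrite eq_sym => nab.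
  by have := edge_nbelow bp; rewrite (lt_parent ap ab).
move=> cp c'p xc xc'.
by case/orP: (below_comparable xc xc') => [/sub->|/sub->].
Qed.

(** [leaf] also holds of numbers that are not vertices, since these have no children; hence the
    membership test. *)
Definition is_leaf T v := (v \in verts T) && leaf (verts T) (edges T) v.

Lemma childrenE T c p : (c \in children (verts T) (edges T) p) = ((c, p) \in edges T).
Proof.
rewrite !inE /=; apply/andP/idP => [[]//|cp].
by have [-> _] := edge_verts cp.
Qed.

Lemma leaf_noedge T v c : leaf (verts T) (edges T) v -> (c, v) \notin edges T.
Proof.
rewrite /leaf /deg cardfs_eq0 => /eqP l; by rewrite -childrenE l inE.
Qed.

Lemma not_leaf T v : ~~ leaf (verts T) (edges T) v -> exists c, (c, v) \in edges T.
Proof.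
rewrite /leaf /deg cardfs_eq0 => /fset0Pn[c]; rewrite childrenE => cv.
by exists c.
Qed.

Lemma leaf_below T v x : leaf (verts T) (edges T) v -> below (edges T) x v -> x = v.
Proof.
move=> lv /asboolP[s]; case/lastP: s => [//|s y].
rewrite last_rcons rcons_path => /andP[_ e] yv; move: e; rewrite yv.
by rewrite (negPf (leaf_noedge _ lv)).
Qed.

Lemma below_leaf T v : v \in verts T -> (forall x, below (edges T) x v -> x = v) ->
  leaf (verts T) (edges T) v.
Proof.
move=> vV min; apply/negPn/negP => /not_leaf[c cv].
by have := edge_neq cv; rewrite (min c (edge_below cv)) eqxx.
Qed.

Lemma root_not_leaf T : ~~ leaf (verts T) (edges T) (root T).
Proof. by rewrite /leaf deg_root. Qed.

Lemma ex_leaf_below T v : v \in verts T ->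
  exists2 x, is_leaf T x & below (edges T) x v.
Proof.
have [n] := ubnP #|` [fset x in verts T | below (edges T) x v]|.
elim: n v => // n IHn v ltn vV.
have [lv|/not_leaf[c cv]] := boolP (leaf (verts T) (edges T) v).
  by exists v; [rewrite /is_leaf vV | apply: below_refl].
have [|x lx xc] := IHn c _ (edge_verts cv).1.
  rewrite -ltnS; apply: leq_trans ltn; rewrite ltnS; apply: fproper_ltn_card.
  rewrite fproperEneq; apply/andP; split; last first.
    apply/fsubsetP => x; rewrite !inE /= => /andP[-> xc].
    exact: below_trans xc (edge_below cv).
  apply/eqP => /fsetP/(_ v).
  by rewrite !inE /= vV below_refl (negPf (edge_nbelow cv)).
by exists x => //; apply: below_trans xc (edge_below cv).
Qed.

Lemma ex_sibling T c p : (c, p) \in edges T -> p != root T ->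
  exists2 d, (d, p) \in edges T & d != c.
Proof.
move=> cp pr; have [_ pV] := edge_verts cp.
have := deg_neq1 pV pr; rewrite /deg (cardfsD1 c) childrenE cp add1n => n1.
have /fset0Pn[d]: children (verts T) (edges T) p `\ c != fset0.
  by apply/negP => /eqP e; apply: n1; rewrite e cardfs0.
by rewrite in_fsetD1 childrenE => /andP[dc dp]; exists d.
Qed.

(** As [w] is not the root, it has a child besides the one above [v]. Siblings have disjoint
    subtrees, so any leaf below that other child will do. *)
Lemma ex_leaf_strictly_below T v w : v \in verts T -> w != root T -> v != w ->
  below (edges T) v w ->
  exists2 x, is_leaf T x & below (edges T) x w && ~~ below (edges T) x v.
Proof.
move=> vV wr vw vlew.
have /asboolP[s] := vlew; case/lastP: s => [/= _ /eqP|s u]; first by rewrite (negPf vw).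
rewrite last_rcons rcons_path => /andP[ps cw] uw; rewrite {}uw in cw.
have vc : below (edges T) v (last v s) by apply/asboolP; exists s.
have [d dw dc] := ex_sibling cw wr.
have [x lx xd] := ex_leaf_below (edge_verts dw).1.
exists x => //; rewrite (below_trans xd (edge_below dw)); apply/negP => xv.
by move: dc; rewrite (siblings_disjoint cw dw (below_trans xv vc) xd) eqxx.
Qed.

End Trees.

(** * Contractions *)

Section Contraction.
Variable R : realType.
Implicit Types T U : merge_tree R.

Definition merge_edges T c p := [fset reparent c p e | e in edges T `\ (c, p)].

(** The only edge with lower end [c] is (c, p), so removing it removes [c] as a lower end. The
    second alternative collects the former children of [c]. *)
Lemma in_merge_edges T c p x y : (c, p) \in edges T ->
  ((x, y) \in merge_edges T c p) =
  (x != c) && ((y != c) && ((x, y) \in edges T) ||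
               (y == p) && ((x, c) \in edges T)).
Proof.
move=> cp; have ncp := edge_neq cp.
apply/imfsetP/idP => /= [[[a b]]|/andP[xc /orP[/andP[yc xy]|/andP[/eqP-> xc']]]].
- rewrite !inE xpair_eqE => /andP[nab ab].
  have nac : a != c.
    apply: contra nab => /eqP ac; move: ab; rewrite ac => cb.
    by rewrite (edge_fun cp cb) !eqxx.
  rewrite /reparent /=; case: eqVneq => [bc|nbc] [-> ->]; rewrite nac /=.
    by rewrite eqxx -bc ab orbT.
  by rewrite nbc ab.
- exists (x, y); rewrite ?inE ?xpair_eqE ?(negPf xc) //.
  by rewrite /reparent /= (negPf yc).
- exists (x, c); rewrite ?inE ?xpair_eqE ?(negPf xc) //.
  by rewrite /reparent /= eqxx.
Qed.

Lemma below_merge T c p x y : (c, p) \in edges T -> x != c -> y != c ->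
  x \in verts T -> below (merge_edges T c p) x y = below (edges T) x y.
Proof.
move=> cp xc yc xV; apply/idP/idP.
  apply: below_sub => u v; rewrite in_merge_edges // => /andP[_].
  case/orP=> /andP[]; first by move=> _ /edge_below.
  by move=> /eqP-> uc; apply: below_trans (edge_below uc) (edge_below cp).
(* The claim is extended to the removed vertex, represented by [p], so that the induction can pass
   through [c]. *)
suff: below (edges T) x y -> below (merge_edges T c p) (if x == c then p else x) y.
  by rewrite (negPf xc).
elim/(@tree_ind R T): x / xV {xc} => [/root_below->|x q xq IHq].
  by rewrite eq_sym (negPf (edge_neq_root cp)); apply: below_refl.
case: eqVneq => [xc|xc] xy.
  move: IHq xq; rewrite xc => + cq; rewrite -(edge_fun cp cq).
  rewrite [p == c]eq_sym (negPf (edge_neq cp)); apply.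
  by apply: lt_parent cp _ yc; rewrite -xc.
case/belowP: xy => [->|[q' xq' q'y]]; first exact: below_refl.
rewrite (edge_fun xq' xq) in q'y; move: (IHq q'y); apply: below_edge.
rewrite in_merge_edges // xc /=; case: (eqVneq q c) => [qc|qc]; last by rewrite qc xq.
by rewrite eqxx -qc xq orbT.
Qed.

Lemma deg2_children T c d p x : (c, p) \in edges T -> (d, p) \in edges T ->
  d != c -> deg (verts T) (edges T) p = 2%N -> (x, p) \in edges T ->
  x = c \/ x = d.
Proof.
move=> cp dp dc deg2; rewrite -(childrenE T).
suff <- : [fset c; d] = children (verts T) (edges T) p.
  by rewrite !inE => /orP[]/eqP->; [left|right].
apply/eqP; rewrite eqEfcard -/(deg _ _ _) deg2 cardfs2 eq_sym dc andbT.
by rewrite fsubUset !fsub1set !childrenE cp dp.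
Qed.

Definition prune_edges T c p d p' :=
  ((d, p') |` edges T) `\` [fset (c, p); (d, p); (p, p')].

(** Parents are unique, so taking out an edge amounts to excluding its lower end; only [d] receives
    a new edge. *)
Lemma in_prune_edges T c p d p' x y :
  (c, p) \in edges T -> (d, p) \in edges T -> (p, p') \in edges T ->
  ((x, y) \in prune_edges T c p d p') =
  (x == d) && (y == p') || [&& x != c, x != d, x != p & (x, y) \in edges T].
Proof.
move=> cp dp pp'; rewrite !inE !xpair_eqE.
have npp' := edge_neq pp'; have ndp := edge_neq dp.
have xE a b : (a, b) \in edges T -> ((x, y) \in edges T) && (x == a) = (x == a) && (y == b).
  move=> ab; case: (eqVneq x a) => [->|]; rewrite ?andbF ?andbT //.
  by apply/idP/eqP => [ay|->//]; apply: edge_fun ay ab.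
case: (eqVneq x d) => [->|nxd] /=; rewrite ?andbF ?orbF ?andbT.
  rewrite (negPf ndp) /= orbF.
  have [->|nyp'] := eqVneq y p'; first by rewrite [p' == p]eq_sym (negPf npp') !andbF.
  apply/negP => /andP[nn dy]; move: nn; by rewrite (edge_fun dy dp) eqxx orbT.
have := xE _ _ cp; have := xE _ _ pp'.
by case: ((x, y) \in _); rewrite ?andbF //= => <- <-; rewrite negb_or !andbT.
Qed.

Lemma below_prune T c p d p' x y :
  (c, p) \in edges T -> (d, p) \in edges T -> (p, p') \in edges T ->
  leaf (verts T) (edges T) c -> d != c -> deg (verts T) (edges T) p = 2%N ->
  x != c -> x != p -> y != c -> y != p -> x \in verts T ->
  below (prune_edges T c p d p') x y = below (edges T) x y.
Proof.
move=> cp dp pp' lc dc deg2 xc xp yc yp xV; apply/idP/idP.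
  apply: below_sub => u v; rewrite in_prune_edges // => /orP[/andP[/eqP-> /eqP->]|].
    exact: below_trans (edge_below dp) (edge_below pp').
  by case/and4P=> _ _ _ /edge_below.
(* Here [p'] represents both removed vertices in the induction. *)
suff: below (edges T) x y ->
    below (prune_edges T c p d p') (if (x == c) || (x == p) then p' else x) y.
  by rewrite (negPf xc) (negPf xp).
elim/(@tree_ind R T): x / xV {xc xp} => [/root_below->|x q xq IHq].
  by case: ifP => [/orP[]|_]; last exact: below_refl;
    rewrite eq_sym ?(negPf (edge_neq_root cp)) ?(negPf (edge_neq_root pp')).
have p'np : ((p' == c) || (p' == p)) = false.
  rewrite [p' == p]eq_sym (negPf (edge_neq pp')) orbF; apply/eqP => p'c.
  by move: (leaf_noedge p lc); rewrite -p'c pp'.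
move=> xy; case: (eqVneq x p) => [xp|xp].
  rewrite orbT; move: IHq xq xy; rewrite xp => + pq py.
  by rewrite -(edge_fun pp' pq) p'np; apply; apply: lt_parent pp' py yp.
case: (eqVneq x c) => [xc|xc] /=.
  move: IHq xq xy; rewrite xc => + cq cy; rewrite -(edge_fun cp cq).
  by rewrite eqxx orbT; apply; apply: lt_parent cp cy yc.
case/belowP: xy => [->|[q' xq' q'y]]; first exact: below_refl.
rewrite (edge_fun xq' xq) in q'y; move: (IHq q'y); apply: below_edge.
rewrite in_prune_edges // xc xp /=; case: (eqVneq q c) => [qc|qc] /=.
  by move: xq; rewrite qc (negPf (leaf_noedge _ lc)).
case: (eqVneq q p) => [qp|qp]; last first.
  case: (eqVneq x d) => [xd|xd] /=; last by rewrite xq.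
  by move: qp; rewrite xd in xq; rewrite (edge_fun xq dp) eqxx.
rewrite eqxx andbT; move: xq; rewrite qp => xp'.
case: (deg2_children cp dp dc deg2 xp') => [xE|->]; last by rewrite eqxx.
by rewrite xE eqxx in xc.
Qed.

End Contraction.

(** * Profiles *)

Section Profiles.
Variable R : realType.
Implicit Types (T U : merge_tree R) (s : nat -> nat) (K A : {fset nat}).

(** A nonroot vertex stands for the edge to its parent, so that sums over edges become sums over
    [nonroots]. *)
Definition wt T v : R := len T (v, parent T v).

Lemma wtE T v p : (v, p) \in edges T -> wt T v = len T (v, p).
Proof. by move=> vp; rewrite /wt (parentE vp). Qed.

Definition nonroots T := verts T `\ root T.

Lemma nonrootsP T v : reflect (exists p, (v, p) \in edges T) (v \in nonroots T).
Proof.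
rewrite in_fsetD1; apply: (iffP andP) => [[vr vV]|[p vp]].
  by exists (parent T v); apply: parentP.
by rewrite (edge_neq_root vp) (edge_verts vp).1.
Qed.

Lemma wt_gt0 T v : v \in nonroots T -> 0 < wt T v.
Proof. by case/nonrootsP => p vp; rewrite (wtE vp); apply: len_gt0. Qed.

Definition mask T s K v : {fset nat} := [fset i in K | below (edges T) (s i) v].

Lemma in_mask T s K v i : (i \in mask T s K v) = (i \in K) && below (edges T) (s i) v.
Proof. by rewrite !inE. Qed.

Lemma mask_sub T s K v : mask T s K v `<=` K.
Proof. by apply/fsubsetP => i; rewrite in_mask => /andP[]. Qed.

(** This is P_T(A); the mask of an edge is that of its lower end. *)
Definition prof T s K A : R :=
  \sum_(v <- nonroots T) (if mask T s K v == A then wt T v else 0).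

Definition leaves T K s := forall i, i \in K -> is_leaf T (s i).

Lemma contractsP T T' c p : contracts (c, p) T T' ->
  [/\ (c, p) \in edges T, p != root T & root T' = root T].
Proof.
case=> [[? ? _ [_ _ ->] _]|[d [p' [[? _ pp'] _ [_ _ ->] _ _]]]] //=.
by split=> //; apply: edge_neq_root pp'.
Qed.

Lemma contracts_vertsP T T' c p v : contracts (c, p) T T' ->
  v \in verts T' -> v \in verts T /\ v != c.
Proof.
case=> [[/= ? ? _ [-> _ _] _]|[d [p' [_ _ [-> _ _] _ _]]]].
  by rewrite in_fsetD1 => /andP[].
by rewrite !inE negb_or => /andP[/andP[]].
Qed.

(** The common invariant of both kinds of contraction; the stability of masks and leaves follows
    from it. *)
Lemma contracts_below T T' c p x y : contracts (c, p) T T' ->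
  x \in verts T' -> y \in verts T' ->
  below (edges T') x y = below (edges T) x y.
Proof.
case=> [[/= cp ? _ [-> -> _] _]|].
  rewrite !in_fsetD1 => /andP[xc xV] /andP[yc _].
  exact: below_merge.
move=> [d [p' [/= [cp lc pp'] [dp dc deg2] [-> -> _] _ _]]].
rewrite !inE !negb_or => /andP[/andP[xc xp] xV] /andP[/andP[yc yp] yV].
exact: below_prune.
Qed.

(** No surviving vertex [v] turns into a leaf: a removed vertex below [v] puts [p] below [v], and
    with it a sibling of [c], which survives strictly below [v]. *)
Lemma contracts_leaf T T' c p v : contracts (c, p) T T' ->
  is_leaf T' v = (v != c) && is_leaf T v.
Proof.
move=> cT; have [cp pr _] := contractsP cT.
have sub := contracts_vertsP cT.
apply/andP/and3P => [[vV lv]|[vc vV lv]].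
  have [vT vc] := sub _ vV; split=> //.
  have ltF x : x \in verts T' -> below (edges T) x v -> x = v.
    by move=> xV; rewrite -(contracts_below cT xV vV); apply: leaf_below lv.
  have [d dp dc] := ex_sibling cp pr.
  apply: (below_leaf vT) => x xv.
  have [/ltF-> //|xV'] := boolP (x \in verts T').
  have pv : below (edges T) p v.
    case: cT xV' vV => [[/= _ _ _ [-> _ _] _]|].
      rewrite in_fsetD1 (below_vertsl xv vT) andbT negbK => /eqP xc _.
      by apply: lt_parent cp _ vc; rewrite -xc.
    move=> [d0 [p' [/= _ _ [-> _ _] _ _]]].
    rewrite !inE (below_vertsl xv vT) andbT negbK => /orP[]/eqP xE _; last by rewrite -xE.
    by apply: lt_parent cp _ vc; rewrite -xE.
  have dv := below_trans (edge_below dp) pv.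
  have dV : d \in verts T'.
    have dT := (edge_verts dp).1.
    case: cT => [[/= _ _ _ [-> _ _] _]|]; first by rewrite in_fsetD1 dc.
    move=> [d0 [p' [/= _ _ [-> _ _] _ _]]].
    by rewrite !inE (negPf dc) (negPf (edge_neq dp)).
  have dE := ltF d dV dv; rewrite -dE in pv.
  by move: (edge_nbelow dp); rewrite pv.
have vV' : v \in verts T'.
  case: cT => [[/= _ _ _ [-> _ _] _]|]; first by rewrite in_fsetD1 vc.
  move=> [d0 [p' [/= _ _ [-> _ _] _ _]]].
  rewrite !inE (negPf vc) vV andbT /=; apply: contraL lv => /eqP->.
  by apply/negP => /(@leaf_noedge _ _ _ c); rewrite cp.
split=> //; apply: (below_leaf vV') => x xv.
have xV' := below_vertsl xv vV'.
by move: xv; rewrite (contracts_below cT xV' vV'); apply: leaf_below lv.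
Qed.

Lemma contracts_mask T T' c p s K v : contracts (c, p) T T' -> leaves T' K s ->
  v \in verts T' -> mask T' s K v = mask T s K v.
Proof.
move=> cT lK vV; apply/fsetP => i; rewrite !in_mask.
have [iK|//] := boolP (i \in K).
by rewrite (contracts_below cT) //; case/andP: (lK i iK).
Qed.

(** Survivors keep their masks, so merging only takes away the edge (c, p). Pruning also fuses two
    edges, but [leaves T' K s] leaves [c] unselected, so both have the same mask and their lengths
    add up within one entry. *)
Lemma contracts_prof T T' c p s K A : contracts (c, p) T T' -> leaves T' K s ->
  prof T s K A = prof T' s K A + (if mask T s K c == A then len T (c, p) else 0).
Proof.
move=> cT lK; have [cp pr rE] := contractsP cT.
have mE v : v \in nonroots T' -> mask T' s K v = mask T s K v.
  by rewrite in_fsetD1 => /andP[_ vV]; apply: contracts_mask cT lK vV.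
have cN : c \in nonroots T by apply/nonrootsP; exists p.
rewrite -(wtE cp) addrC {1}/prof (big_fsetD1 c cN) /=; congr (_ + _).
case: (cT) => [[/= _ _ _ [VE EE _] lE]|].
  have NE : nonroots T `\ c = nonroots T' by rewrite /nonroots VE rE fsetDDl fsetUC -fsetDDl.
  rewrite NE; apply: eq_fbigr => v vN _; rewrite (mE v vN); case: ifP => // _.
  have /nonrootsP[q vq] := vN; rewrite (wtE vq).
  move: vq; rewrite EE => /imfsetP[[a b] /= ab].
  rewrite /reparent /= => vqE; rewrite vqE; have := lE _ ab; rewrite /reparent /= => ->.
  have -> : v = a by move: vqE; case: (b == c) => -[].
  by move: ab; rewrite in_fsetD1 => /andP[_ ab]; rewrite (wtE ab).
move=> [d [p' [/= [_ lc pp'] [dp dc deg2] [VE EE _] ldE lE]]].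
have NE : nonroots T `\ c `\ p = nonroots T'.
  rewrite /nonroots VE rE; apply/fsetP => v; rewrite !inE negb_or.
  by case: (v == root T); rewrite ?andbF //= andbCA andbA.
have ndp := edge_neq dp.
have pN : p \in nonroots T `\ c.
  rewrite in_fsetD1 eq_sym (edge_neq cp); apply/nonrootsP; by exists p'.
have dN : d \in nonroots T `\ c `\ p.
  by rewrite !in_fsetD1 ndp dc (edge_neq_root dp) (edge_verts dp).1.
rewrite (big_fsetD1 p pN) (big_fsetD1 d dN) /= /prof -NE (big_fsetD1 d dN) /= NE addrA.
have dN' : d \in nonroots T' by rewrite -NE.
congr (_ + _).
  (* p and d only differ by the unselected leaf c. *)
  have -> : mask T s K p = mask T s K d.
    apply/fsetP => i; rewrite !in_mask; have [iK /=|//] := boolP (i \in K).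
    have := lK i iK; rewrite (contracts_leaf _ cT) => /andP[sic /andP[siV lsi]].
    apply/idP/idP => [|sid]; last exact: below_trans sid (edge_below dp).
    move=> /asboolP[w]; case/lastP: w => [/= _ sip|w u].
      by move: lsi => /(@leaf_noedge _ _ _ c); rewrite sip cp.
    rewrite last_rcons rcons_path => /andP[pw lwu] up; rewrite {}up in lwu.
    have siw : below (edges T) (s i) (last (s i) w) by apply/asboolP; exists w.
    case: (deg2_children cp dp dc deg2 lwu) => wE; last by rewrite -wE.
    rewrite wE in siw; by move: sic; rewrite (leaf_below lc siw) eqxx.
  have d'E : (d, p') \in edges T' by rewrite EE in_prune_edges // !eqxx.
  rewrite (mE d dN') (wtE d'E) ldE (wtE pp') (wtE dp).
  by case: ifP => _; rewrite ?addr0.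
apply: eq_fbigr => v /fsetD1P[vd vN] _; rewrite (mE v vN); case: ifP => // _.
have /nonrootsP[q vq] := vN; rewrite (wtE vq) lE //; last first.
  by rewrite xpair_eqE (negPf vd).
move: vq; rewrite EE in_prune_edges // (negPf vd) /= => /and3P[_ _ vq].
by rewrite (wtE vq).
Qed.

End Profiles.

(** * Existence of contractions *)

Section ExistsContraction.
Variable R : realType.
Implicit Types T : merge_tree R.

Lemma in_children (V : {fset nat}) (E : {fset edge}) x v :
  (x \in children V E v) = (x \in V) && ((x, v) \in E).
Proof. by rewrite !inE. Qed.

Lemma exists_unique_parent (E : {fset edge}) x q :
  (forall y, ((x, y) \in E) = (y == q)) -> exists! y, (x, y) \in E.
Proof.
by move=> xE; exists q; split=> [|y]; rewrite xE // => /eqP.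
Qed.

Lemma deg_neq1_of2 (V : {fset nat}) (E : {fset edge}) a b v :
  a != b -> a \in children V E v -> b \in children V E v -> deg V E v <> 1%N.
Proof.
move=> ab aC bC d1.
have /fsubset_leq_card : [fset a; b] `<=` children V E v.
  by rewrite fsubUset !fsub1set aC.
by rewrite cardfs2 ab -/(deg V E v) d1.
Qed.

Lemma ex_contracts_merge T c p : (c, p) \in edges T -> p != root T ->
  (2 < deg (verts T) (edges T) p)%N || ~~ leaf (verts T) (edges T) c ->
  exists T', contracts (c, p) T T'.
Proof.
move=> cp pr big; have ncp := edge_neq cp.
have cr := edge_neq_root cp; have [cV pV] := edge_verts cp.
pose V := verts T `\ c; pose E := merge_edges T c p.
have inE' x y : ((x, y) \in E) = (x != c) && ((y != c) && ((x, y) \in edges T) ||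
               (y == p) && ((x, c) \in edges T)) by exact: in_merge_edges.
have edgeT x y : (x, y) \in E -> x != c /\ exists z, (x, z) \in edges T.
  by rewrite inE' => /andP[-> /orP[]/andP[_ xz]]; split=> //; eexists; exact: xz.
have ch v : v != p -> v != c -> children V E v = children (verts T) (edges T) v.
  move=> vp vc; apply/fsetP => x; rewrite childrenE !inE /= inE' vc (negPf vp) /= orbF.
  have [->|xc] /= := eqVneq x c.
    by apply/esym/negP => /(edge_fun cp) pv; rewrite pv eqxx in vp.
  by apply/andP/idP => [[]//|xv]; rewrite (edge_verts xv).1.
have tree : rooted_tree V E (root T).
  split.
  - by rewrite in_fsetD1 eq_sym cr root_verts.
  - move=> x y; rewrite inE' !in_fsetD1 => /andP[-> /orP[]/andP[]].
      by move=> -> /edge_verts[-> ->].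
    by move=> /eqP-> /edge_verts[-> _]; rewrite eq_sym ncp pV.
  - by move=> q; apply/negP => /edgeT[_ [z /edge_neq_root]]; rewrite eqxx.
  - move=> x; rewrite in_fsetD1 => /andP[xc xV] xr.
    have xq := parentP xV xr; set q := parent T x in xq.
    apply: (@exists_unique_parent _ _ (if q == c then p else q)) => y.
    have xz z : ((x, z) \in edges T) = (z == q).
      by apply/idP/eqP => [/(edge_fun xq)|->].
    rewrite inE' xc !xz /= [c == q]eq_sym.
    case: (eqVneq q c) => [qc|qc]; rewrite ?andbT ?andbF ?orbF ?qc.
      by case: (eqVneq y c); rewrite ?andbF.
    by case: (eqVneq y q) => [->|]; rewrite ?andbF // qc.
  - move=> v; rewrite in_fsetD1 => /andP[vc vV]; apply/asboolP.
    rewrite -/(below E v (root T)) (below_merge cp vc _ vV) ?below_root //.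
    by rewrite eq_sym.
have dr : deg V E (root T) = 1%N by rewrite /deg ch 1?eq_sym // -/(deg _ _ _) deg_root.
have dn v : v \in V -> v != root T -> deg V E v <> 1%N.
  rewrite in_fsetD1 => /andP[vc vV] vr.
  have [vp|vp] := eqVneq v p; last by rewrite /deg ch //; apply: deg_neq1.
  have chE x z : x != c -> (x, z) \in edges T -> (z == p) || (z == c) ->
      x \in children V E v.
    move=> xc xz zE; rewrite !inE /= xc (edge_verts xz).1 inE' xc vp eqxx /=.
    by case/orP: zE xz => /eqP-> ->; rewrite ?orbT // andbT eq_sym ncp.
  (* [p] must keep two children: either it had three, or [c] is inner and hands its own children, at
     least two, to [p]. *)
  case/orP: big => [d3|/not_leaf[a ac]].
    have [a ap nac] := ex_sibling cp pr.
    have /fset0Pn[b] : children (verts T) (edges T) p `\` [fset c; a] != fset0.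
      rewrite fsetD_eq0; apply: contraTN d3 => /fsubset_leq_card.
      by rewrite -leqNgt cardfs2 eq_sym nac.
    rewrite in_fsetD childrenE !inE negb_or => /andP[/andP[bc ba] bp].
    by apply: (deg_neq1_of2 ba); [apply: chE bc bp _ | apply: chE nac ap _]; rewrite eqxx.
  have [b bc ba] := ex_sibling ac cr.
  by apply: (deg_neq1_of2 ba); [apply: chE (edge_neq bc) bc _ |
    apply: chE (edge_neq ac) ac _]; rewrite eqxx orbT.
have lpos e : e \in E -> 0 < wt T e.1.
  case: e => x y /edgeT[_ [z xz]]; apply: wt_gt0; apply/nonrootsP.
  by exists z.
(* Merging changes only the upper end of an edge, so the old length is read off the lower end. *)
exists (@MergeTree R V E (root T) (fun e => wt T e.1) tree dr dn lpos).
left; split=> //= -[x y]; rewrite in_fsetD1 => /andP[_ xy].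
by rewrite /reparent /= -(wtE xy); case: ifP.
Qed.

Lemma ex_contracts_prune T c p : (c, p) \in edges T -> p != root T ->
  deg (verts T) (edges T) p = 2%N -> leaf (verts T) (edges T) c ->
  exists T', contracts (c, p) T T'.
Proof.
move=> cp pr deg2 lc; have ncp := edge_neq cp.
have cr := edge_neq_root cp; have [cV pV] := edge_verts cp.
have pp' := parentP pV pr; set p' := parent T p in pp'.
have npp' := edge_neq pp'; have [_ p'V] := edge_verts pp'.
have [d dp dc] := ex_sibling cp pr; have ndp := edge_neq dp.
have [dV _] := edge_verts dp.
have np'c : p' != c.
  by apply: contraTneq pp' => ->; apply: (@leaf_noedge R).
pose V := verts T `\` [fset c; p]; pose E := prune_edges T c p d p'.
have inE' x y : ((x, y) \in E) =
    (x == d) && (y == p') || [&& x != c, x != d, x != p & (x, y) \in edges T].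
  exact: in_prune_edges.
have inV x : (x \in V) = [&& x != c, x != p & x \in verts T].
  by rewrite !inE negb_or andbA.
have edgeT x y : (x, y) \in E -> exists z, (x, z) \in edges T.
  rewrite inE' => /orP[/andP[/eqP-> _]|/and4P[_ _ _ xy]]; first by exists p.
  by exists y.
have cnE x : (x, c) \in edges T = false by apply: negPf; apply: leaf_noedge lc.
have tree : rooted_tree V E (root T).
  split.
  - by rewrite inV eq_sym cr eq_sym pr root_verts.
  - move=> x y; rewrite inE' !inV => /orP[/andP[/eqP-> /eqP->]|].
      by rewrite dc ndp dV np'c p'V eq_sym npp'.
    move=> /and4P[xc xd xp xy]; rewrite xc xp; have [-> ->] := edge_verts xy.
    split=> //; rewrite andbT; apply/andP; split; apply: contraTneq xy => ->.
      by rewrite cnE.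
    apply/negP => /(deg2_children cp dp dc deg2)[]/eqP; first by rewrite (negPf xc).
    by rewrite (negPf xd).
  - by move=> q; apply/negP => /edgeT[z /edge_neq_root]; rewrite eqxx.
  - move=> x; rewrite inV => /and3P[xc xp xV] xr.
    apply: (@exists_unique_parent _ _ (if x == d then p' else parent T x)) => y.
    rewrite inE' xc xp /=; case: (eqVneq x d) => [_|_] /=; first by rewrite orbF.
    apply/idP/eqP => [/parentE //|->]; exact: parentP.
  - move=> v; rewrite inV => /and3P[vc vp vV]; apply/asboolP.
    rewrite -/(below E v (root T)) (below_prune cp dp pp' lc dc deg2 vc vp) //.
    - exact: below_root.
    - by rewrite eq_sym.
    - by rewrite eq_sym.
(* [p'] exchanges the child [p] for [d], and the other survivors keep their children. *)
have dE v : v \in V -> deg V E v = deg (verts T) (edges T) v.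
  rewrite inV => /and3P[vc vp vV].
  have chE x : (x \in children V E v) = ((x, v) \in E).
    rewrite in_children; apply/andP/idP => [[]//|xv]; split=> //.
    by case: tree => _ /(_ _ _ xv)[].
  have [vp'|vp'] := eqVneq v p'.
    have -> : deg V E v = #|` d |` (children (verts T) (edges T) v `\ p)|.
      congr #|` _|; apply/fsetP => x; rewrite chE inE' vp' eqxx andbT.
      rewrite in_fset1U in_fsetD1 childrenE.
      have [//|xd] /= := eqVneq x d; have [->|//] := eqVneq x c.
      rewrite /=; apply/esym/negP => /andP[_ cp'].
      by rewrite (edge_fun cp cp') eqxx in npp'.
    rewrite cardfsU1 in_fsetD1 childrenE vp'.
    have -> : (d, p') \in edges T = false.
      by apply/negP => dp'; rewrite (edge_fun dp dp') eqxx in npp'.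
    by rewrite andbF /= /deg [RHS](cardfsD1 p) childrenE pp'.
  congr #|` _|; apply/fsetP => x; rewrite chE inE' childrenE (negPf vp') andbF /=.
  apply/and4P/idP => [[]//|xv]; split=> //; apply/eqP => xE.
  - by rewrite xE in xv; rewrite (edge_fun cp xv) eqxx in vp.
  - by rewrite xE in xv; rewrite (edge_fun dp xv) eqxx in vp.
  - by rewrite xE in xv; rewrite (edge_fun pp' xv) eqxx in vp'.
have rV : root T \in V by case: tree.
have dr : deg V E (root T) = 1%N by rewrite dE // deg_root.
have dn v : v \in V -> v != root T -> deg V E v <> 1%N.
  by move=> vV; rewrite dE //; apply: deg_neq1; move: vV; rewrite inV => /and3P[].
pose l (e : edge) : R := if e.1 == d then wt T p + wt T d else wt T e.1.
have lpos e : e \in E -> 0 < l e.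
  have wtpos x z : (x, z) \in edges T -> 0 < wt T x.
    by move=> xz; apply: wt_gt0; apply/nonrootsP; exists z.
  case: e => x y /edgeT[z xz]; rewrite /l /=; case: ifP => _; last exact: wtpos xz.
  by rewrite addr_gt0 ?(wtpos _ _ pp') ?(wtpos _ _ dp).
exists (@MergeTree R V E (root T) l tree dr dn lpos).
right; exists d, p'; split=> //=.
  by rewrite /l eqxx (wtE pp') (wtE dp).
move=> [x y]; rewrite inE' /l /= xpair_eqE.
case: (eqVneq x d) => [_|_] /=; first by rewrite andbF orbF => ->.
by move=> /and3P[_ _ xy] _; rewrite (wtE xy).
Qed.

(** If merging is excluded, [c] is a leaf and [p] has at most two children, hence exactly two as it
    is not the root: pruning applies. *)
Lemma ex_contracts T c p : (c, p) \in edges T -> p != root T ->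
  exists T', contracts (c, p) T T'.
Proof.
move=> cp pr.
case big : ((2 < deg (verts T) (edges T) p)%N || ~~ leaf (verts T) (edges T) c).
  exact: ex_contracts_merge.
move/norP: big => /= []; rewrite -leqNgt negbK => d2 lc.
apply: ex_contracts_prune => //; apply/eqP; rewrite eqn_leq d2 /=.
have [d dp dc] := ex_sibling cp pr.
have /fsubset_leq_card : [fset d; c] `<=` children (verts T) (edges T) p.
  by rewrite fsubUset !fsub1set !childrenE dp.
by rewrite cardfs2 dc.
Qed.

End ExistsContraction.

(** * Isomorphisms and edit sequences *)

Section Isomorphisms.
Variable R : realType.
Implicit Types (T U : merge_tree R) (s : nat -> nat) (K A : {fset nat}).

(** The isomorphism is named because selections are transported along it. *)
Definition iso_by (f : nat -> nat) T T' : Prop :=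
  [/\ {in verts T &, injective f},
      verts T' = [fset f x | x in verts T],
      root T' = f (root T),
      {in verts T &, forall x y, ((f x, f y) \in edges T') = ((x, y) \in edges T)}
    & forall x y, (x, y) \in edges T -> len T' (f x, f y) = len T (x, y)].

Lemma iso_verts f T T' x : iso_by f T T' -> x \in verts T -> f x \in verts T'.
Proof. by case=> _ -> _ _ _ xV; apply: in_imfset. Qed.

Lemma iso_vertsP f T T' y : iso_by f T T' -> y \in verts T' ->
  exists2 x, x \in verts T & y = f x.
Proof. by case=> _ -> _ _ _ /imfsetP. Qed.

Lemma iso_edge f T T' x y : iso_by f T T' ->
  (x, y) \in edges T -> (f x, f y) \in edges T'.
Proof.
by case=> _ _ _ eE _ xy; have [xV yV] := edge_verts xy; rewrite eE.
Qed.

Lemma iso_inv f T T' : iso_by f T T' ->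
  exists2 g, iso_by g T' T & {in verts T, cancel f g}.
Proof.
move=> fP; have [fI VE rE eE lE] := fP.
(* [f] is injective on the vertices only, so preimages are chosen there; 0 is a placeholder off the
   image. *)
pose g y := xget 0%N (fun x => x \in verts T /\ f x = y).
have gK : {in verts T, cancel f g}.
  move=> x xV; rewrite /g; case: xgetP => [z _ [zV /fI]|/(_ x)[]//]; exact.
have VP := @iso_vertsP _ _ _ _ fP.
exists g => //; split.
- by move=> a b /VP[x xV ->] /VP[y yV ->]; rewrite !gK // => ->.
- apply/fsetP => x; apply/idP/imfsetP => [xV|[y /= /VP[z zV ->] ->]]; last by rewrite gK.
  by exists (f x); rewrite ?gK //=; apply: iso_verts fP xV.
- by rewrite rE gK ?root_verts.
- by move=> a b /VP[x xV ->] /VP[y yV ->]; rewrite !gK // eE.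
- move=> a b ab; have [aV bV] := edge_verts ab; move: ab.
  have [[x xV ->] [y yV ->]] := (VP _ aV, VP _ bV).
  by rewrite eE // !gK // => /lE.
Qed.

Lemma isom_sym T T' : isom T T' -> isom T' T.
Proof. by move=> [f /iso_inv[g gP _]]; exists g. Qed.

Lemma isom_trans T1 T2 T3 : isom T1 T2 -> isom T2 T3 -> isom T1 T3.
Proof.
move=> [f fP] [g gP]; exists (g \o f).
have [fI VE rE eE lE] := fP; have [gI VE' rE' eE' lE'] := gP.
have fV x := @iso_verts _ _ _ x fP.
split=> /=.
- by move=> x y xV yV /gI e; apply: fI => //; apply: e; apply: fV.
- by rewrite VE' VE -imfset_comp.
- by rewrite rE' rE.
- by move=> x y xV yV; rewrite eE' ?eE //; apply: fV.
- by move=> x y xy; rewrite lE' ?lE //; apply: iso_edge fP xy.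
Qed.

Lemma isom_same T T' : verts T' = verts T -> edges T' = edges T ->
  root T' = root T -> {in edges T, len T' =1 len T} -> isom T T'.
Proof.
move=> VE EE rE lE; exists id; split=> //.
- by rewrite VE imfset_id.
- by move=> x y _ _; rewrite EE.
- by move=> x y /lE.
Qed.

Lemma isom_refl T : isom T T.
Proof. exact: isom_same. Qed.

Lemma iso_below_imp f T T' x y : iso_by f T T' ->
  below (edges T) x y -> below (edges T') (f x) (f y).
Proof.
move=> fP /asboolP[s]; elim: s x => [|u s IHs] x /=.
  by move=> _ ->; apply: below_refl.
by case/andP=> xu ps ls; apply: below_edge (iso_edge fP xu) (IHs _ ps ls).
Qed.

Lemma iso_below f T T' x y : iso_by f T T' -> x \in verts T -> y \in verts T ->
  below (edges T') (f x) (f y) = below (edges T) x y.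
Proof.
move=> fP xV yV; apply/idP/idP => [fxy|]; last exact: iso_below_imp.
have [g gP gK] := iso_inv fP.
by have := iso_below_imp gP fxy; rewrite !gK.
Qed.

Lemma iso_leaf f T T' x : iso_by f T T' -> is_leaf T x -> is_leaf T' (f x).
Proof.
move=> fP /andP[xV lx]; have fxV := iso_verts fP xV.
rewrite /is_leaf fxV /=; apply: (below_leaf fxV) => z zx.
have [y yV zE] := iso_vertsP fP (below_vertsl zx fxV).
rewrite zE in zx *; congr f; apply: leaf_below lx _.
by rewrite -(iso_below fP).
Qed.

Lemma iso_leaves f T T' K s : iso_by f T T' -> leaves T K s ->
  leaves T' K (f \o s).
Proof. by move=> fP lK i iK; apply: iso_leaf fP (lK i iK). Qed.

Lemma iso_prof f T T' K s A : iso_by f T T' -> leaves T K s ->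
  prof T' (f \o s) K A = prof T s K A.
Proof.
move=> fP lK; have [fI VE rE eE lE] := fP.
have NE : nonroots T' = [fset f x | x in nonroots T].
  apply/fsetP => y; apply/idP/imfsetP => /= [|[x]]; rewrite !in_fsetD1 => /andP[].
    move=> yr /(iso_vertsP fP)[x xV yE]; exists x => //=.
    by rewrite in_fsetD1 xV andbT; apply: contraNneq yr => xr; rewrite rE yE xr.
  move=> xr xV ->; rewrite (iso_verts fP xV) andbT rE.
  by apply: contraNneq xr => /fI->//; apply: root_verts.
rewrite /prof NE big_imfset /=; last first.
  by move=> x y; rewrite !in_fsetD1 => /andP[_ xV] /andP[_ yV]; apply: fI.
apply: eq_big_seq => x; rewrite in_fsetD1 => /andP[xr xV].
have xp := parentP xV xr.
rewrite (wtE (iso_edge fP xp)) lE // -(wtE xp).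
congr (if _ == _ then _ else _); apply/fsetP => i; rewrite !in_mask.
case iK : (i \in K) => //=; rewrite (iso_below fP) //.
by case/andP: (lK i iK).
Qed.

End Isomorphisms.

(** * Edit sequences: concatenation, reversal, cost zero *)

Section Sequences.
Variables (R : realType) (b : bool).
Implicit Types (T U : merge_tree R).

(** The flag [b] treats both distances at once: [true] demands one-degree sequences, [false] admits
    all. *)
Definition reachable T U (x : R) : Prop :=
  exists S, [/\ transforms T S U, b -> one_degree S & seq_cost S = x].

Lemma reachable_isoml T T' U x : isom T T' -> reachable T' U x -> reachable T U x.
Proof.
move=> TT' [S [tS oS cS]]; exists S; split=> //.
case: S tS {oS cS} => [|o S] /=; first exact: isom_trans.
by case=> /(isom_trans TT').
Qed.

Lemma reachable_isom T U : isom T U -> reachable T U 0.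
Proof. by move=> TU; exists [::]; split=> //; rewrite /seq_cost big_nil. Qed.

Lemma reachable_trans T U W x y :
  reachable T U x -> reachable U W y -> reachable T W (x + y).
Proof.
move=> [S [tS oS <-]] UW {x}; elim: S T tS oS => [|o S IHS] T /=.
  by move=> TU _; rewrite /seq_cost big_nil add0r; apply: reachable_isoml TU UW.
move=> [Tb tS] oS; have [|S' [tS' oS' cS']] := IHS _ tS.
  by move=> /oS/andP[].
exists (o :: S'); split=> //=.
  by move=> bT; rewrite (oS' bT); case/andP: (oS bT) => ->.
by rewrite /seq_cost !big_cons -!/(seq_cost _) cS' addrA.
Qed.

Lemma reachable_step (o : edit_step R) : (b -> step_one_degree o) ->
  reachable (before o) (after o) (step_cost o).
Proof.
move=> o1; exists [:: o]; split=> /=.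
- by split; apply: isom_refl.
- by move=> /o1->.
- by rewrite /seq_cost big_seq1.
Qed.

Lemma reachable_contract T T' e : contracts e T T' ->
  (b -> leaf (verts T) (edges T) e.1) -> reachable T T' (len T e).
Proof.
move=> cT le; have [eT _ _] : [/\ e \in edges T, e.2 != root T & root T' = root T].
  by case: e cT {le} => c p /contractsP.
have := @reachable_step (@EditStep R T (Contract R e) T' cT) le.
by rewrite /step_cost /= /cost subr0 ger0_norm // ltW // len_gt0.
Qed.

Lemma reachable_insert T T' e : contracts e T T' ->
  (b -> leaf (verts T) (edges T) e.1) -> reachable T' T (len T e).
Proof.
move=> cT le; have [eT _ _] : [/\ e \in edges T, e.2 != root T & root T' = root T].
  by case: e cT {le} => c p /contractsP.
have := @reachable_step (@EditStep R T' (Insert R e) T cT) le.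
by rewrite /step_cost /= /cost sub0r normrN ger0_norm // ltW // len_gt0.
Qed.

Lemma reachable_relabel T T' e v : relabels e v T T' ->
  reachable T T' `|len T e - v|.
Proof.
by move=> rT; apply: (@reachable_step (@EditStep R T (Relabel e v) T' rT)).
Qed.

(** A relabelling is undone by restoring the old label; contraction and insertion undo each other.
    Cost and leaf condition of the latter two refer to the larger tree, so reversal preserves
    them. *)
Lemma reachable_back (o : edit_step R) : (b -> step_one_degree o) ->
  reachable (after o) (before o) (step_cost o).
Proof.
case: o => T [e v|e|e] T' aT; rewrite /step_cost /step_one_degree /= => o1.
- have [eT [VE EE rE] le lE] := aT.
  have aT' : relabels e (len T e) T' T.
    split=> //; first by rewrite EE.
    by move=> e' e'T e'e; rewrite lE // -EE.
  by have := reachable_relabel aT'; rewrite le distrC.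
- have := reachable_insert aT o1; rewrite /cost subr0 ger0_norm // ltW // len_gt0 //.
  by case: e aT {o1} => c p /contractsP[].
- have := reachable_contract aT o1; rewrite /cost sub0r normrN ger0_norm // ltW // len_gt0 //.
  by case: e aT {o1} => c p /contractsP[].
Qed.

Lemma reachable_sym T U x : reachable T U x -> reachable U T x.
Proof.
move=> [S [tS oS <-]] {x}; elim: S T tS oS => [|o S IHS] T /=.
  by move=> TU _; rewrite /seq_cost big_nil; apply: reachable_isom (isom_sym TU).
move=> [Tb tS] oS; rewrite /seq_cost big_cons -/(seq_cost S) addrC.
have o1 : b -> step_one_degree o by move=> /oS/andP[].
have oS' : b -> one_degree S by move=> /oS/andP[].
apply: reachable_trans (IHS _ tS oS') _; rewrite -[step_cost o]addr0.
apply: reachable_trans (reachable_back o1) _.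
exact: reachable_isom (isom_sym Tb).
Qed.

Lemma reachable_isomr T U U' x : isom U U' -> reachable T U x -> reachable T U' x.
Proof.
move=> UU' TU; rewrite -[x]addr0; apply: reachable_trans TU _.
exact: reachable_isom.
Qed.

Lemma step_cost_ge0 (o : edit_step R) : 0 <= step_cost o.
Proof. by case: o => T [e v|e|e] T' aT; apply: normr_ge0. Qed.

Lemma reachable_ge0 T U x : reachable T U x -> 0 <= x.
Proof.
by move=> [S [_ _ <-]]; apply: sumr_ge0 => o _; apply: step_cost_ge0.
Qed.

(** Labels are positive, so contractions and insertions are never free, and a free relabelling
    changes no label. *)
Lemma step_cost0 (o : edit_step R) : step_cost o = 0 -> isom (before o) (after o).
Proof.
case: o => T [e v|e|e] T' aT; rewrite /step_cost /cost /=.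
- case: aT => _ [VE EE rE] le lE /eqP; rewrite normr_eq0 subr_eq0 => /eqP ev.
  apply: isom_same => // e' e'T; case: (eqVneq e' e) => [->|/lE->//].
  by rewrite le ev.
- case: e aT => c p /contractsP[cp _ _] /eqP.
  by rewrite subr0 normr_eq0 gt_eqF // len_gt0.
- case: e aT => c p /contractsP[cp _ _] /eqP.
  by rewrite sub0r normrN normr_eq0 gt_eqF // len_gt0.
Qed.

Lemma reachable0 T U : reachable T U 0 -> isom T U.
Proof.
move=> [S [tS _ /eqP]]; rewrite /seq_cost => c0; elim: S T tS c0 => [//|o S IHS] T /= [Tb tS].
rewrite big_cons paddr_eq0 ?step_cost_ge0 ?sumr_ge0 //; last by move=> *; apply: step_cost_ge0.
case/andP=> /eqP/step_cost0 ba /(IHS _ tS).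
exact: isom_trans (isom_trans Tb ba).
Qed.

End Sequences.

(** * Costs of mappings *)

Section ProfileCost.
Variable R : realType.
Implicit Types (K A B : {fset nat}) (a u : {fset nat} -> R).

(** [a] and [u] stand for P_T and P_U. All masks are subsets of [K], so the sum covers every
    nonempty one. *)
Definition fcost K a u : R :=
  a fset0 + u fset0 + \sum_(A <- fpowerset K `\ fset0) `|a A - u A|.

Lemma fcostC K a u : fcost K a u = fcost K u a.
Proof.
rewrite /fcost [a fset0 + _]addrC; congr (_ + _).
by apply: eq_bigr => A _; rewrite distrC.
Qed.

Lemma fcost_add0 K a a1 u x :
  (forall A, a1 A = a A + (if fset0 == A then x else 0)) ->
  fcost K a1 u = fcost K a u + x.
Proof.
move=> a1E; rewrite /fcost a1E eqxx.
under eq_big_seq => A.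
  rewrite in_fsetD1 => /andP[A0 _]; rewrite a1E eq_sym (negPf A0) addr0; over.
by rewrite /=; lra.
Qed.

(** An entry enters the cost linearly, through one absolute value, or, off the subsets of [K], not
    at all; so its change moves the cost by at most that amount. *)
Lemma fcost_add K a a1 u B x :
  (forall A, a1 A = a A + (if B == A then x else 0)) ->
  fcost K a1 u <= fcost K a u + `|x|.
Proof.
have [->|B0] := eqVneq B fset0.
  by move=> h; rewrite (fcost_add0 K u h) (lerD2l (fcost K a u)) ler_norm.
move=> a1E; rewrite /fcost a1E (negPf B0) addr0 -[leRHS]addrA lerD2l.
have [BK|BK] := boolP (B \in fpowerset K `\ fset0).
  rewrite (big_fsetD1 B BK) [in leRHS](big_fsetD1 B BK) /= a1E eqxx.
  rewrite [leRHS]addrAC.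
  apply: lerD; last first.
    rewrite le_eqVlt; apply/orP; left; apply/eqP; apply: eq_big_seq => A.
    by rewrite in_fsetD1 => /andP[AB _]; rewrite a1E eq_sym (negPf AB) addr0.
  by rewrite addrAC; apply: ler_normD.
rewrite -[leLHS]addr0; apply: lerD => //.
rewrite le_eqVlt; apply/orP; left; apply/eqP; apply: eq_big_seq => A AK.
rewrite a1E; case: (eqVneq B A) => [BA|_]; last by rewrite addr0.
by rewrite BA AK in BK.
Qed.

Lemma fcost_eq K a a1 u u1 : a =1 a1 -> u =1 u1 -> fcost K a u = fcost K a1 u1.
Proof.
by move=> aE uE; rewrite /fcost aE uE; congr (_ + _); apply: eq_bigr => A _; rewrite aE uE.
Qed.

(** Each subset without [i] is paired with the one that has [i] added. The partner of the excluded
    empty set is the singleton, which stands alone. *)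
Lemma big_fpowerset K i (G : {fset nat} -> R) : i \in K ->
  \sum_(A <- fpowerset K `\ fset0) G A =
  G [fset i] + \sum_(A <- fpowerset (K `\ i) `\ fset0) (G A + G (i |` A)).
Proof.
move=> iK; rewrite big_split /= (big_fsetID _ (fun A : {fset nat} => i \in A)) /= addrC addrCA.
congr (_ + _).
  apply: eq_fbigl => A; rewrite !inE !fpowersetE fsubsetD1.
  by rewrite andbA.
rewrite (_ : [fset x in _ | _] = [fset i |` A | A in fpowerset (K `\ i)]); last first.
  apply/fsetP => A; rewrite !inE fpowersetE; apply/idP/imfsetP => [/andP[/andP[_ AK] iA]|].
    exists (A `\ i); rewrite ?fsetD1K //= fpowersetE fsubsetD1 in_fsetD1 eqxx andbT.
    exact: fsubset_trans (fsubD1set _ _) AK.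
  move=> [B]; rewrite /= fpowersetE => BK ->; rewrite fset1U1 andbT.
  rewrite fsubUset fsub1set iK (fsubset_trans BK (fsubD1set _ _)) !andbT.
  by apply/fset0Pn; exists i; rewrite fset1U1.
rewrite big_imfset /=; last first.
  move=> A B; rewrite !fpowersetE !fsubsetD1 => /andP[_ iA] /andP[_ iB] e.
  by rewrite -(fsetU1K iA) e fsetU1K.
rewrite (big_fsetD1 fset0) ?fpowersetE ?fsub0set //=.
by rewrite fsetU0.
Qed.

End ProfileCost.

(** * Profiles of selections, and mappings *)

Section Mappings.
Variables (R : realType).
Implicit Types (T U : merge_tree R) (s t : nat -> nat) (K A : {fset nat}).

Lemma prof_ge0 T s K A : 0 <= prof T s K A.
Proof.
rewrite /prof big_seq; apply: sumr_ge0 => v vN.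
by case: ifP => // _; apply/ltW/wt_gt0.
Qed.

(** Positive lengths make the support of a profile purely combinatorial; relabelling therefore
    cannot alter it. *)
Lemma prof_eq0 T s K A :
  (prof T s K A == 0) = all (fun v => mask T s K v != A) (nonroots T).
Proof.
rewrite /prof big_seq psumr_eq0; last first.
  by move=> v vN; case: ifP => // _; apply/ltW/wt_gt0.
apply/allP/allP => h v vN; have := h v vN; rewrite ?vN /=.
  by case: ifP => // _; rewrite gt_eqF // wt_gt0.
by case: ifP.
Qed.

Lemma prof_gt0 T s K A v : v \in nonroots T -> mask T s K v = A -> 0 < prof T s K A.
Proof.
move=> vN mv; rewrite lt_neqAle prof_ge0 andbT eq_sym prof_eq0.
by apply/allPn; exists v => //; rewrite mv eqxx.
Qed.

Lemma prof_out T s K A : ~~ (A `<=` K) -> prof T s K A = 0.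
Proof.
move=> AK; apply/eqP; rewrite prof_eq0; apply/allP => v _.
by apply: contraNneq AK => <-; apply: mask_sub.
Qed.

Definition selection T K s := {in K &, injective s} /\ leaves T K s.

Lemma leaf_nonroots T v : is_leaf T v -> v \in nonroots T.
Proof.
case/andP=> vV lv; rewrite in_fsetD1 vV andbT.
by apply: contraTneq lv => ->; apply: root_not_leaf.
Qed.

Lemma mask_leaf T K s i : selection T K s -> i \in K -> mask T s K (s i) = [fset i].
Proof.
move=> [sI sL] iK; apply/fsetP => j; rewrite in_mask in_fset1.
apply/andP/eqP => [[jK]|->]; last by rewrite below_refl.
by have /andP[_ li] := sL i iK; move=> /(leaf_below li)/sI->.
Qed.

Lemma mask_other_leaf T K s c : leaf (verts T) (edges T) c ->
  (forall i, i \in K -> s i != c) -> mask T s K c = fset0.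
Proof.
move=> lc sc; apply/fsetP => i; rewrite in_mask in_fset0.
by apply/negP => /andP[/sc + /(leaf_below lc) e]; rewrite e eqxx.
Qed.

Lemma prof_single T K s i : selection T K s -> i \in K -> 0 < prof T s K [fset i].
Proof.
move=> sS iK; apply: (@prof_gt0 _ _ _ _ (s i)); last exact: mask_leaf.
by apply: leaf_nonroots; case: sS => _; apply.
Qed.

(** Forgetting the label [i] identifies masks that differ only in [i]. *)
Lemma prof_remove T s K i A : i \in K -> i \notin A ->
  prof T s (K `\ i) A = prof T s K A + prof T s K (i |` A).
Proof.
move=> iK iA; rewrite /prof -big_split /=; apply: eq_bigr => v _.
have -> : mask T s (K `\ i) v = mask T s K v `\ i.
  by apply/fsetP => j; rewrite !(in_mask, in_fsetD1) andbA.
have [im|im] := boolP (i \in mask T s K v).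
  have -> : (mask T s K v == A) = false by apply: contraNF iA => /eqP<-.
  rewrite add0r; congr (if _ then _ else _).
  by apply/eqP/eqP => [<-|->]; [rewrite fsetD1K | rewrite fsetU1K].
have -> : (mask T s K v == i |` A) = false.
  by apply: contraNF im => /eqP->; rewrite fset1U1.
rewrite addr0; congr (if _ == _ then _ else _).
by apply/fsetP => j; rewrite in_fsetD1; case: eqVneq => // ->; rewrite (negPf im).
Qed.

(** The empty mask is exempt: its edges can be deleted leaf by leaf even in one-degree sequences. *)
Definition same_support (a u : {fset nat} -> R) :=
  forall A, A != fset0 -> (a A == 0) = (u A == 0).

(** [K] is nonempty because the edge at the root cannot be contracted, so that some leaf always
    survives. *)
Definition mapping (b : bool) T U K s t :=
  [/\ K != fset0, selection T K s, selection U K t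
    & b -> same_support (prof T s K) (prof U t K)].

Definition mcost T U K s t := fcost K (prof T s K) (prof U t K).

End Mappings.

(** * No edit sequence beats the cheapest mapping *)

Section LowerBound.
Variables (R : realType) (b : bool).
Implicit Types (T U : merge_tree R) (s : nat -> nat) (K A : {fset nat}).

(* Labelling the selected leaves by those of U, i.e. t := id, loses no generality
   and leaves only finitely many mappings. *)
Definition bounded T U (x : R) : Prop :=
  exists K s, mapping b T U K s id /\ mcost T U K s id <= x.

(** Select all leaves of [U] and their images in [T]: the profiles agree, and no edge has an empty
    mask. *)
Lemma bounded_isom T U : isom T U -> bounded T U 0.
Proof.
move=> /isom_sym[f fP]; pose K := [fset v in verts U | is_leaf U v].
have KE v : v \in K = is_leaf U v by rewrite !inE /= /is_leaf andbA andbb.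
have lK : leaves U K id by move=> v; rewrite KE.
have KV v : v \in K -> v \in verts U by rewrite KE => /andP[].
have pE A : prof T f K A = prof U id K A by rewrite -(iso_prof A fP lK).
exists K, f; split; last first.
  rewrite /mcost (fcost_eq K pE (fun=> erefl)) /fcost.
  rewrite big1 ?addr0 => [|A _]; last by rewrite subrr normr0.
  suff /eqP-> : prof U id K fset0 == 0 by rewrite addr0.
  rewrite prof_eq0; apply/allP => v; rewrite in_fsetD1 => /andP[_ vV].
  have [l ll lv] := ex_leaf_below vV; apply/fset0Pn; exists l.
  by rewrite in_mask KE ll.
split=> //.
- have [l ll _] := ex_leaf_below (root_verts U); apply/fset0Pn; exists l.
  by rewrite KE.
- split; last by move=> i iK; apply: iso_leaf fP (lK i iK).
  by case: fP => fI _ _ _ _ i j /KV iV /KV jV; apply: fI.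
- by split=> // ? ? _ _.
- by move=> _ A _; rewrite pE.
Qed.

Lemma bounded_isoml T T' U x : isom T T' -> bounded T' U x -> bounded T U x.
Proof.
move=> /isom_sym[f fP] [K [s [[K0 [sI sL] tS supp] le]]].
have pE A : prof T (f \o s) K A = prof T' s K A by apply: iso_prof.
exists K, (f \o s); split; last first.
  by apply: le_trans le; rewrite /mcost (fcost_eq K pE (fun=> erefl)).
split=> //.
- split; last exact: iso_leaves sL.
  case: fP => fI _ _ _ _ i j iK jK /= /fI e; apply: sI => //.
  by apply: e; [case/andP: (sL i iK)|case/andP: (sL j jK)].
- by move=> bT A A0; rewrite pE supp.
Qed.

(** Masks do not depend on lengths, so the same selection serves and a single profile entry changes,
    by the difference of the labels. *)
Lemma bounded_relabel T T' U e v x : relabels e v T T' -> bounded T' U x ->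
  bounded T U (`|len T e - v| + x).
Proof.
move=> [eT [VE EE rE] ve lE] [K [s [[K0 [sI sL] tS supp] le]]].
have NE : nonroots T' = nonroots T by rewrite /nonroots VE rE.
have mE w : mask T' s K w = mask T s K w by rewrite /mask EE.
exists K, s; split.
  split=> //; first split=> //.
    by move=> i /sL; rewrite /is_leaf VE EE.
  move=> bT A A0; rewrite -supp // !prof_eq0 NE.
  by apply: eq_all => w; rewrite mE.
rewrite addrC; have eN : e.1 \in nonroots T.
  by apply/nonrootsP; exists e.2; rewrite -surjective_pairing.
apply: le_trans (lerD le (lexx _)).
apply: (@fcost_add _ _ _ _ _ (mask T s K e.1)) => A.
rewrite /prof NE (big_fsetD1 e.1 eN) [in RHS](big_fsetD1 e.1 eN) /= mE.
have wE : wt T e.1 = len T e by rewrite (@wtE _ _ _ e.2) -surjective_pairing.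
have wE' : wt T' e.1 = v by rewrite (@wtE _ _ _ e.2) -surjective_pairing // EE.
rewrite wE wE' [RHS]addrAC; congr (_ + _).
  by case: ifP; rewrite ?addr0 // addrC subrK.
apply: eq_big_seq => w; rewrite in_fsetD1 mE => /andP[we /nonrootsP[q wq]].
rewrite (wtE wq) (@wtE _ T' w q) ?EE // lE //.
by apply: contraNneq we => <-.
Qed.

(** Leaves of [T'] are leaves of [T], so the selection is kept and one entry grows by the contracted
    length. In the one-degree case [c] is an unselected leaf, so this is the entry of the empty mask
    and the supports are unaffected. *)
Lemma bounded_contract T T' U c p x : contracts (c, p) T T' ->
  (b -> leaf (verts T) (edges T) c) ->
  bounded T' U x -> bounded T U (len T (c, p) + x).
Proof.
move=> cT bc [K [s [[K0 [sI sL] tS supp] le]]].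
have pE := contracts_prof _ cT sL.
have sc i : i \in K -> s i != c.
  by move=> /sL; rewrite (contracts_leaf _ cT) => /andP[].
have [cp _ _] := contractsP cT.
exists K, s; split.
  split=> //; first split=> //.
    by move=> i /sL; rewrite (contracts_leaf _ cT) => /andP[].
  move=> bT A A0; rewrite pE (mask_other_leaf (bc bT)) //.
  by rewrite [fset0 == A]eq_sym (negPf A0) addr0 supp.
rewrite addrC; apply: le_trans (lerD le (lexx _)).
rewrite -[X in _ + X]ger0_norm ?(ltW (len_gt0 cp)) //.
exact: fcost_add pE.
Qed.

(** All selected leaves of [T'] survive in [T], so the argument for contractions applies with the
    opposite sign. *)
Lemma bounded_insert_unselected T T' U c p K s : contracts (c, p) T' T ->
  (b -> leaf (verts T') (edges T') c) ->
  mapping b T' U K s id -> (forall i, i \in K -> s i != c) ->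
  bounded T U (len T' (c, p) + mcost T' U K s id).
Proof.
move=> cT bc [K0 [sI sL] tS supp] sc; have [cp _ _] := contractsP cT.
have sL' : leaves T K s.
  by move=> i iK; rewrite (contracts_leaf _ cT) sc // sL.
have pE := contracts_prof _ cT sL'.
exists K, s; split.
  split=> // bT A A0; rewrite -supp // pE (mask_other_leaf (bc bT)) //.
  by rewrite [fset0 == A]eq_sym (negPf A0) addr0.
rewrite addrC -[X in _ + X]ger0_norm ?(ltW (len_gt0 cp)) // -normrN.
apply: (@fcost_add _ _ _ _ _ (mask T' s K c)) => A; rewrite pE.
by case: ifP; rewrite ?addr0 // addrK.
Qed.

(* Some other selected leaf lies below p, so (c, p) is the only edge with mask
   [fset i0]: dropping the label i0 raises the cost by at most 2 len (c, p), and
   undoing the insertion saves len (c, p). *)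
Lemma bounded_insert_remove T T' U c p K s i0 i1 : contracts (c, p) T' T ->
  mapping b T' U K s id -> i0 \in K -> s i0 = c ->
  i1 \in K -> i1 != i0 -> below (edges T') (s i1) p ->
  bounded T U (len T' (c, p) + mcost T' U K s id).
Proof.
move=> cT [K0 sS tS supp] i0K si0 i1K i10 i1p; have [cp _ _] := contractsP cT.
have [[sI sL] [_ tL]] := (sS, tS).
have lc : leaf (verts T') (edges T') c by rewrite -si0; case/andP: (sL _ i0K).
set K2 := K `\ i0; have K2K i : i \in K2 -> i \in K /\ i != i0.
  by rewrite in_fsetD1 => /andP[].
have sc i : i \in K2 -> s i != c.
  move=> /K2K[iK ii0]; apply: contraNneq ii0; rewrite -si0 => /sI e.
  by apply/eqP/e.
have sL' : leaves T K2 s.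
  by move=> i iK; rewrite (contracts_leaf _ cT) sc // sL //; case: (K2K i iK).
have pE A : prof T' s K2 A =
    prof T s K2 A + (if fset0 == A then len T' (c, p) else 0).
  by rewrite (contracts_prof _ cT sL') (mask_other_leaf lc).
have pc : prof T' s K [fset i0] = len T' (c, p).
  have cN : c \in nonroots T' by apply/nonrootsP; exists p.
  rewrite /prof (big_fsetD1 c cN) /= -{1}si0 (mask_leaf sS i0K) eqxx (wtE cp).
  rewrite big_seq big1 ?addr0 // => v; rewrite in_fsetD1 => /andP[vc vN].
  case: eqP => // mv; have := fset11 i0; rewrite -{1}mv in_mask si0 => /andP[_ cv].
  suff : i1 \in mask T' s K v by rewrite mv in_fset1 (negPf i10).
  by rewrite in_mask i1K (below_trans i1p (lt_parent cp cv vc)).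
exists K2, s; split; last first.
  rewrite -[leRHS]addrC; have -> : mcost T U K2 s id = mcost T' U K2 s id - len T' (c, p).
    by rewrite /mcost (fcost_add0 _ _ pE) addrK.
  rewrite lerBlDr -addrA /mcost /fcost (big_fpowerset _ i0K).
  rewrite !prof_remove // fsetU0 pc.
  (* Dropping [i0] adds up paired entries on both sides; the triangle inequality bounds each new
     term by the two old ones. *)
  have : \sum_(A <- fpowerset K2 `\ fset0) `|prof T' s K2 A - prof U id K2 A| <=
         \sum_(A <- fpowerset K2 `\ fset0) (`|prof T' s K A - prof U id K A| +
           `|prof T' s K (i0 |` A) - prof U id K (i0 |` A)|).
    rewrite [leLHS]big_seq [leRHS]big_seq; apply: ler_sum => A.
    rewrite in_fsetD1 fpowersetE fsubsetD1 => /and3P[_ _ i0A].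
    by rewrite !prof_remove // opprD addrACA ler_normD.
  have := ler_norm (prof U id K [fset i0] - len T' (c, p)); rewrite distrC.
  by lra.
split=> //.
- by apply/fset0Pn; exists i1; rewrite in_fsetD1 i10.
- by split=> // i j /K2K[iK _] /K2K[jK _]; apply: sI.
- by split=> // i /K2K[iK _]; apply: tL.
- move=> bT A A0; have [AK2|AK2] := boolP (A `<=` K2); last by rewrite !prof_out.
  have -> : prof T s K2 A = prof T' s K2 A by rewrite pE [fset0 == A]eq_sym (negPf A0) addr0.
  have i0A : i0 \notin A by move: AK2; rewrite fsubsetD1 => /andP[].
  (* A sum of two nonnegative entries vanishes only if both do, so the agreement of supports
     survives the pairing. *)
  rewrite !prof_remove // !paddr_eq0 ?prof_ge0 // !supp //.
  by apply/fset0Pn; exists i0; rewrite fset1U1.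
Qed.

(* No other selected leaf lies below p: let another leaf y below p take the label of
   c. Only edges strictly below p, of total length Q + len (c, p), change masks. *)
Lemma bounded_insert_swap T T' U c p K s i0 : contracts (c, p) T' T ->
  mapping b T' U K s id -> i0 \in K -> s i0 = c ->
  (forall i, i \in K -> below (edges T') (s i) p -> i = i0) ->
  bounded T U (len T' (c, p) + mcost T' U K s id).
Proof.
move=> cT [K0 sS tS supp] i0K si0 i0p; have [cp pr _] := contractsP cT.
have [sI sL] := sS.
have lc : leaf (verts T') (edges T') c by rewrite -si0; case/andP: (sL _ i0K).
have [y ly /andP[yp nyc]] :=
  ex_leaf_strictly_below (edge_verts cp).1 pr (edge_neq cp) (edge_below cp).
have yc : y != c by apply: contraNneq nyc => ->; apply: below_refl.
pose s2 i := if i == i0 then y else s i.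
have s2i i : i != i0 -> s2 i = s i by rewrite /s2 => /negPf->.
have s2i0 : s2 i0 = y by rewrite /s2 eqxx.
have sy i : i \in K -> s i != y.
  move=> iK; apply/eqP => siy; move: yp; rewrite -siy => /(i0p i iK) ii0.
  by rewrite ii0 si0 in siy; rewrite siy eqxx in yc.
have s2c i : i \in K -> s2 i != c.
  rewrite /s2; case: (eqVneq i i0) => [_ _ //|ii0 iK]; apply: (contraNneq _ ii0).
  by rewrite -si0 => /sI e; apply/eqP/e.
have s2L : leaves T K s2.
  move=> i iK; rewrite (contracts_leaf _ cT) s2c //= /s2.
  by case: ifP => // _; apply: sL.
have s2S : selection T K s2.
  split=> // i j iK jK; rewrite /s2; case: eqVneq => [->|_]; case: eqVneq => [->|_] //.
  - by move=> ysj; have := sy j jK; rewrite ysj eqxx.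
  - by move=> siy; have := sy i iK; rewrite siy eqxx.
  - exact: sI.
have cN : c \in nonroots T' by apply/nonrootsP; exists p.
(* These are the edges from [y] up to [p]. When the label moves from [c] to [y], their masks change
   from [fset0] to [[fset i0]]. *)
pose q v := below (edges T') y v && ~~ below (edges T') c v.
pose Q := \sum_(v <- nonroots T' `\ c) (if q v then wt T' v else 0).
have Q0 : 0 <= Q.
  rewrite /Q big_seq; apply: sumr_ge0 => v; rewrite in_fsetD1 => /andP[_ vN].
  by case: ifP => // _; apply/ltW/wt_gt0.
(* [a] records only the exchange at [[fset i0]], where (c, p) leaves and the path of length [Q]
   enters. What remains is the loss of [Q] at the empty mask. *)
pose a A := prof T' s K A + (if [fset i0] == A then Q - len T' (c, p) else 0).
have mv v : v != c -> v \in nonroots T' ->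
    if q v then mask T' s K v = fset0 /\ mask T' s2 K v = [fset i0]
    else mask T' s2 K v = mask T' s K v.
  move=> vc vN; case: ifP => [/andP[yv ncv]|/negbT].
    have vp : below (edges T') v p.
      case/orP: (below_comparable yv yp) => // pv.
      by rewrite (below_trans (edge_below cp) pv) in ncv.
    have none i : i \in K -> i != i0 -> below (edges T') (s i) v = false.
      move=> iK ii0; apply: contraNF ii0 => siv.
      by rewrite (i0p i iK) // (below_trans siv vp).
    split; apply/fsetP => i; rewrite in_mask ?in_fset0 ?in_fset1.
      case iK : (i \in K) => //=; have [->|ii0] := eqVneq i i0; last exact: none.
      by rewrite si0 (negPf ncv).
    have [->|ii0] := eqVneq i i0; first by rewrite i0K s2i0.
    by rewrite s2i //; case iK : (i \in K) => //=; apply: none.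
  rewrite negb_and negbK => cvy; apply/fsetP => i; rewrite !in_mask.
  have [->|ii0] := eqVneq i i0; last by rewrite s2i.
  congr (_ && _); rewrite s2i0 si0; apply/idP/idP => [yv|cv].
    by rewrite yv in cvy.
  exact: below_trans yp (lt_parent cp cv vc).
have pE A : prof T s2 K A = a A + (if fset0 == A then - Q else 0).
  have mc0 : mask T' s2 K c = fset0 by apply: mask_other_leaf.
  have -> : prof T s2 K A = prof T' s2 K A - (if fset0 == A then len T' (c, p) else 0).
    by rewrite (contracts_prof A cT s2L) mc0 addrK.
  rewrite /a /prof (big_fsetD1 c cN) [in RHS](big_fsetD1 c cN) /= mc0.
  have -> : mask T' s K c = [fset i0] by rewrite -si0 mask_leaf.
  rewrite (wtE cp).
  have -> : \sum_(v <- nonroots T' `\ c) (if mask T' s2 K v == A then wt T' v else 0) =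
     \sum_(v <- nonroots T' `\ c) (if mask T' s K v == A then wt T' v else 0) +
     ((if [fset i0] == A then Q else 0) - (if fset0 == A then Q else 0)).
    have ifQ (B : bool) : (if B then Q else 0) =
      \sum_(v <- nonroots T' `\ c) (if B then if q v then wt T' v else 0 else 0).
      by case: B => //; rewrite big1.
    rewrite !ifQ -sumrB -big_split /=; apply: eq_big_seq => v.
    rewrite in_fsetD1 => /andP[vc vN]; have := mv v vc vN.
    case: ifP => [_ [-> ->]|_ ->]; last by rewrite !if_same subr0 addr0.
    by rewrite addrCA subrr addr0.
  by case: ifP => _; case: ifP => _; lra.
exists K, s2; split; last first.
  (* The entry at [[fset i0]] costs at most [Q + len T' (c, p)] more, and the empty mask saves
     [Q]. *)
  rewrite /mcost (fcost_add0 _ _ pE).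
  have : fcost K a (prof U id K) <= fcost K (prof T' s K) (prof U id K)
      + `|Q - len T' (c, p)| by apply: fcost_add.
  have := ler_normB Q (len T' (c, p)); rewrite (ger0_norm Q0) (ger0_norm (ltW (len_gt0 cp))).
  by lra.
split=> // bT A A0; have [AE|AE] := eqVneq A [fset i0].
  by rewrite AE !gt_eqF ?prof_single.
by rewrite -supp // pE /a [fset0 == A]eq_sym (negPf A0) [_ == A]eq_sym (negPf AE) !addr0.
Qed.

Lemma bounded_insert T T' U c p x : contracts (c, p) T' T ->
  (b -> leaf (verts T') (edges T') c) ->
  bounded T' U x -> bounded T U (len T' (c, p) + x).
Proof.
move=> cT bc [K [s [sM le]]].
suff [K' [s' [M' le']]] : bounded T U (len T' (c, p) + mcost T' U K s id).
  by exists K', s'; split=> //; apply: le_trans le' _; rewrite lerD2l.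
have [[i0 [i0K si0]]|nc] := pselect (exists i, i \in K /\ s i = c); last first.
  apply: bounded_insert_unselected => // i iK.
  by apply/eqP => sic; apply: nc; exists i.
have [[i1 [i1K i10 i1p]]|ni] := pselect
    (exists i, [/\ i \in K, i != i0 & below (edges T') (s i) p]).
  exact: bounded_insert_remove i1K i10 i1p.
apply: bounded_insert_swap i0K si0 _ => // i iK ip.
by apply/eqP/negPn/negP => ii0; apply: ni; exists i.
Qed.

(** Induction from the end of the sequence: prepending an operation raises the bound by its cost. *)
Lemma reachable_bounded T U x : reachable b T U x -> bounded T U x.
Proof.
move=> [S [tS oS <-]] {x}; elim: S T tS oS => [|o S IHS] T /=.
  by move=> TU _; rewrite /seq_cost big_nil; apply: bounded_isom.
move=> [Tb tS] oS; rewrite /seq_cost big_cons -/(seq_cost S).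
apply: bounded_isoml Tb _.
have o1 : b -> step_one_degree o by move=> /oS/andP[].
have {}IHS : bounded (after o) U (seq_cost S) by apply: IHS tS _ => /oS/andP[].
case: o o1 IHS {tS oS} => T0 [e v|[c p]|[c p]] T1 aT;
  rewrite /step_one_degree /step_cost /cost /=.
- by move=> _; apply: bounded_relabel.
- have [cp _ _] := contractsP aT.
  by rewrite subr0 ger0_norm ?(ltW (len_gt0 cp)) //; apply: bounded_contract.
- have [cp _ _] := contractsP aT.
  by rewrite sub0r normrN ger0_norm ?(ltW (len_gt0 cp)) //; apply: bounded_insert.
Qed.

End LowerBound.

(** * Every mapping is realised by an edit sequence *)

Section Reconstruction.
Variable R : realType.
Implicit Types (T U : merge_tree R) (s t : nat -> nat) (K A : {fset nat}).

Definition exhausts T K s := forall v, is_leaf T v -> exists2 i, i \in K & s i = v.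

(** A leaf below [v] is selected, hence also below [w], so [v] and [w] are comparable. If [w] were
    strictly below [v], some leaf below [v] would not be below [w], contradicting the inclusion of
    masks. *)
Lemma mask_below T K s v w : selection T K s -> exhausts T K s ->
  v \in nonroots T -> w \in nonroots T ->
  below (edges T) v w = (mask T s K v `<=` mask T s K w).
Proof.
move=> sS sK; rewrite !in_fsetD1 => /andP[vr vV] /andP[wr wV].
apply/idP/fsubsetP => [vw i|sub].
  by rewrite !in_mask => /andP[-> /below_trans]; apply.
have [l ll lv] := ex_leaf_below vV.
have [i iK si] := sK l ll; rewrite -si in lv.
have : i \in mask T s K w by apply: sub; rewrite in_mask iK.
rewrite in_mask iK /= => iw; case/orP: (below_comparable lv iw) => // wv.
have [<-|nwv] := eqVneq w v; first exact: below_refl.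
have [x lx /andP[xv]] := ex_leaf_strictly_below wV vr nwv wv.
have [j jK sj] := sK x lx; rewrite -sj in xv *.
suff : j \in mask T s K w by rewrite in_mask => /andP[_ ->].
by apply: sub; rewrite in_mask jK.
Qed.

Lemma mask_inj T K s : selection T K s -> exhausts T K s ->
  {in nonroots T &, injective (mask T s K)}.
Proof.
move=> sS sK v w vN wN e.
by apply: (@below_anti R T); rewrite (mask_below sS sK) // e fsubset_refl.
Qed.

Lemma mask_neq0 T K s v : exhausts T K s -> v \in nonroots T ->
  mask T s K v != fset0.
Proof.
move=> sK; rewrite in_fsetD1 => /andP[_ vV].
have [l ll lv] := ex_leaf_below vV; have [i iK si] := sK l ll.
by apply/fset0Pn; exists i; rewrite in_mask iK si.
Qed.

Lemma prof_mask T K s v : selection T K s -> exhausts T K s ->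
  v \in nonroots T -> prof T s K (mask T s K v) = wt T v.
Proof.
move=> sS sK vN; rewrite /prof (big_fsetD1 v vN) /= eqxx big_seq big1 ?addr0 // => w.
rewrite in_fsetD1 => /andP[wv wN]; case: eqP => // /(mask_inj sS sK wN vN) e.
by rewrite e eqxx in wv.
Qed.

Lemma prof_neq0P T K s A : prof T s K A != 0 ->
  exists2 v, v \in nonroots T & mask T s K v = A.
Proof. by rewrite prof_eq0 => /allPn[v vN /negPn/eqP mv]; exists v. Qed.

(** Edges are the covering pairs of the descendant order, so a bijection that respects this order
    respects edges. *)
Lemma edge_cover T x y : x \in verts T ->
  (x, y) \in edges T <-> [/\ x != y, below (edges T) x y &
    forall z, z \in verts T -> below (edges T) x z -> below (edges T) z y ->
      z = x \/ z = y].
Proof.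
move=> xV; split=> [xy|[nxy xy cov]].
  split; [exact: edge_neq xy|exact: edge_below|move=> z zV xz zy].
  have [->|zx] := eqVneq z x; [by left|right].
  exact: below_anti zy (lt_parent xy xz zx).
case/belowP: xy => [xy|[z xz zy]]; first by rewrite xy eqxx in nxy.
have [_ zV] := edge_verts xz.
have [zx|<- //] := cov z zV (edge_below xz) zy.
by have := edge_neq xz; rewrite zx eqxx.
Qed.

(** Once all leaves are selected, the profile determines the tree: its support is the set of nonroot
    vertices, inclusion is the descendant order, and the entries are the lengths. *)
Lemma prof_isom T U K s t : selection T K s -> exhausts T K s ->
  selection U K t -> exhausts U K t -> prof T s K =1 prof U t K -> isom T U.
Proof.
move=> sS sK tS tK pE.
have matching T1 T2 s1 s2 v : selection T1 K s1 -> exhausts T1 K s1 ->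
    prof T1 s1 K =1 prof T2 s2 K -> v \in nonroots T1 ->
    exists2 u, u \in nonroots T2 & mask T2 s2 K u = mask T1 s1 K v.
  move=> sS1 sK1 e vN; apply: prof_neq0P.
  by rewrite -e (prof_mask sS1 sK1 vN) gt_eqF // wt_gt0.
(* Vertices are matched by their masks. The root is treated apart because its mask [K] is also that
   of its child. *)
pose f v := if v == root T then root U else
  xget 0%N (fun u => u \in nonroots U /\ mask U t K u = mask T s K v).
have fr : f (root T) = root U by rewrite /f eqxx.
have fN v : v \in nonroots T -> f v \in nonroots U /\ mask U t K (f v) = mask T s K v.
  move=> vN; have [u uN mu] := matching _ _ _ _ v sS sK pE vN.
  move: (vN); rewrite in_fsetD1 => /andP[/negPf vr _]; rewrite /f vr.
  by case: xgetP => [u' _ //|/(_ u)[]].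
have NV (T' : merge_tree R) v : v \in verts T' -> v = root T' \/ v \in nonroots T'.
  by move=> vV; rewrite in_fsetD1 vV andbT; have [->|] := eqVneq v (root T'); [left|right].
have NV' (T' : merge_tree R) v : v \in nonroots T' -> v != root T' /\ v \in verts T'.
  by rewrite in_fsetD1 => /andP[].
have fV v : v \in verts T -> f v \in verts U.
  by case/NV=> [->|/fN[/NV'[]//]]; rewrite fr root_verts.
have f_below x y : x \in verts T -> y \in verts T ->
    below (edges U) (f x) (f y) = below (edges T) x y.
  move=> xV; case/NV=> [->|yN]; first by rewrite fr !below_root // fV.
  have [fyN fym] := fN y yN.
  case/NV: xV => [->|xN].
    rewrite fr; apply/idP/idP => /root_below yr.
      by have [] := NV' _ _ fyN; rewrite yr eqxx.
    by have [] := NV' _ _ yN; rewrite yr eqxx.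
  have [fxN fxm] := fN x xN.
  by rewrite (mask_below sS sK) // (mask_below tS tK) // fxm fym.
have f_inj : {in verts T &, injective f}.
  move=> x y xV yV e; apply: (@below_anti R T); rewrite -f_below // e;
  exact: below_refl.
have f_surj u : u \in verts U -> exists2 v, v \in verts T & f v = u.
  case/NV=> [->|uN]; first by exists (root T); rewrite ?root_verts.
  have [v vN mv] := matching _ _ _ _ u tS tK (fsym pE) uN.
  exists v; first by case: (NV' _ _ vN).
  have [fvN fvm] := fN v vN; apply: (mask_inj tS tK) => //.
  by rewrite fvm mv.
have f_edge : {in verts T &, forall x y, ((f x, f y) \in edges U) = ((x, y) \in edges T)}.
  move=> x y xV yV; apply/idP/idP => /edge_cover[|nxy xy cov]; rewrite ?fV //.
    apply/edge_cover => //; split; first by apply: contraNneq nxy => ->.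
      by rewrite -f_below.
    move=> z zV xz zy; have [|||/f_inj->|/f_inj->] := cov (f z); rewrite ?fV ?f_below //.
      by left.
    by right.
  apply/edge_cover; first exact: fV.
  split; first by apply: contraNneq nxy => /f_inj->.
    by rewrite f_below.
  move=> _ /f_surj[z zV <-]; rewrite !f_below // => xz zy.
  by have [->|->] := cov z zV xz zy; [left|right].
exists f; split=> //.
- apply/fsetP => u; apply/idP/imfsetP => [/f_surj[v vV <-]|[v /= vV ->]]; last exact: fV.
  by exists v.
- move=> x y xy; have [xV yV] := edge_verts xy.
  have xN : x \in nonroots T by apply/nonrootsP; exists y.
  have [fxN fxm] := fN x xN.
  rewrite -(wtE xy) -(prof_mask sS sK xN) pE -fxm (prof_mask tS tK fxN).
  by rewrite (@wtE _ _ _ (f y)) // f_edge.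
Qed.

End Reconstruction.

(** * Realising a mapping by successive cheap operations *)

Section Achieving.
Variables (R : realType) (b : bool).
Implicit Types (T U : merge_tree R) (s t : nat -> nat) (K A : {fset nat}).

Lemma fcost_change K (a a1 u : {fset nat} -> R) B : B `<=` K -> B != fset0 ->
  (forall A, A != B -> a1 A = a A) ->
  fcost K a u = fcost K a1 u + `|a B - u B| - `|a1 B - u B|.
Proof.
move=> BK B0 a1E; rewrite /fcost a1E 1?eq_sym //.
have BP : B \in fpowerset K `\ fset0 by rewrite in_fsetD1 B0 fpowersetE.
rewrite (big_fsetD1 B BP) [in RHS](big_fsetD1 B BP) /=.
have -> : \sum_(A <- fpowerset K `\ fset0 `\ B) `|a1 A - u A| =
          \sum_(A <- fpowerset K `\ fset0 `\ B) `|a A - u A|.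
  by apply: eq_big_seq => A; rewrite in_fsetD1 => /andP[AB _]; rewrite a1E.
by lra.
Qed.

Lemma mapping_sym T U K s t : mapping b T U K s t -> mapping b U T K t s.
Proof.
by move=> [K0 sS tS supp]; split=> // bT A A0; rewrite supp.
Qed.

Lemma below_root_child T c v : (c, root T) \in edges T -> v \in nonroots T ->
  below (edges T) v c.
Proof.
move=> cr; rewrite in_fsetD1 => /andP[vr vV].
have /asboolP[w] := below_root vV; case/lastP: w => [/= _ /eqP|w z].
  by rewrite (negPf vr).
rewrite last_rcons rcons_path => /andP[pw lr] zr; rewrite {}zr in lr.
have vl : below (edges T) v (last v w) by apply/asboolP; exists w.
suff -> : c = last v w by [].
have /fset1P : c \in [fset last v w]; last by [].
suff <- : children (verts T) (edges T) (root T) = [fset last v w] by rewrite childrenE.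
apply/esym/eqP; rewrite eqEfcard fsub1set childrenE lr cardfs1.
by rewrite -/(deg _ _ _) deg_root.
Qed.

(** A greedy move: its price is covered by the drop in mapping cost, and the vertex count falls. *)
Definition reduces T U K s t := exists T' x,
  [/\ reachable b T T' x, mapping b T' U K s t,
      mcost T' U K s t + x <= mcost T U K s t
    & (#|` verts T'| < #|` verts T|)%N].

Lemma contracts_card T T' c p : contracts (c, p) T T' ->
  (#|` verts T'| < #|` verts T|)%N.
Proof.
move=> cT; have [cp _ _] := contractsP cT; apply: fproper_ltn_card.
rewrite fproperEneq; apply/andP; split; last first.
  by apply/fsubsetP => v /(contracts_vertsP cT)[].
apply/eqP => VE; have := (edge_verts cp).1; rewrite -VE.
by move=> /(contracts_vertsP cT)[_]; rewrite eqxx.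
Qed.

(** An unselected leaf edge counts with its full length in the entry of the empty mask, which is
    exactly what its contraction costs. *)
Lemma reduces_leaf T U K s t c : mapping b T U K s t -> is_leaf T c ->
  (forall i, i \in K -> s i != c) -> reduces T U K s t.
Proof.
move=> [K0 [sI sL] tS supp] lc sc; have /andP[_ lc'] := lc.
have /nonrootsP[p cp] := leaf_nonroots lc.
(* Otherwise every leaf would lie below [c] and so equal [c], although [K] is nonempty and avoids
   [c]. *)
have pr : p != root T.
  have /fset0Pn[i iK] := K0; apply/eqP => pr; rewrite pr in cp.
  have sic := below_root_child cp (leaf_nonroots (sL i iK)).
  by have := sc i iK; rewrite (leaf_below lc' sic) eqxx.
have [T' cT] := ex_contracts cp pr.
have sL' : leaves T' K s by move=> i iK; rewrite (contracts_leaf _ cT) sc //= sL.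
have pE A : prof T s K A = prof T' s K A + (if fset0 == A then len T (c, p) else 0).
  by rewrite (contracts_prof _ cT sL') mask_other_leaf.
exists T', (len T (c, p)); split.
- by apply: reachable_contract cT _.
- split=> // bT A A0; rewrite -supp // pE [fset0 == A]eq_sym (negPf A0).
  by rewrite addr0.
- by rewrite /mcost (fcost_add0 _ _ pE).
- exact: contracts_card cT.
Qed.

(** At a mask missing in [U] the cost is the entry of [T] itself, so contracting saves the length
    that it costs. The edge at the root is no such edge, as its mask [K] also occurs in [U]; nor is
    a selected leaf edge, whose mask is a singleton. *)
Lemma reduces_inner T U K s t c : ~~ b -> mapping b T U K s t ->
  c \in nonroots T -> mask T s K c != fset0 -> prof U t K (mask T s K c) = 0 ->
  reduces T U K s t.
Proof.
move=> nb [K0 sS tS supp] cN mc0 pU0; have [sI sL] := sS.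
have /nonrootsP[p cp] := cN.
have pr : p != root T.
  apply/eqP => pr; rewrite pr in cp.
  have /not_leaf[c' cr'] := @root_not_leaf _ U.
  have mE : mask U t K c' = K.
    apply/fsetP => i; rewrite in_mask andb_idr // => iK.
    by apply: below_root_child cr' _; apply: leaf_nonroots; case: tS => _; apply.
  have mE' : mask T s K c = K.
    apply/fsetP => i; rewrite in_mask andb_idr // => iK.
    by apply: below_root_child cp _; apply: leaf_nonroots; apply: sL.
  have cN' : c' \in nonroots U by apply/nonrootsP; exists (root U).
  by have := prof_gt0 cN' (etrans mE (esym mE')); rewrite pU0 ltxx.
have lc : ~~ is_leaf T c.
  apply/negP => /andP[cV lc]; have /fset0Pn[i] := mc0.
  rewrite in_mask => /andP[iK /(leaf_below lc) sic].
  have := prof_single tS iK.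
  by rewrite -(mask_leaf sS iK) sic pU0 ltxx.
have [T' cT] := ex_contracts cp pr.
have sL' : leaves T' K s.
  move=> i iK; rewrite (contracts_leaf _ cT) sL // andbT.
  by apply: contraNneq lc => <-; apply: sL.
have pE A := contracts_prof A cT sL'.
have k0 := ltW (len_gt0 cp).
exists T', (len T (c, p)); split.
- by apply: reachable_contract cT _; rewrite (negPf nb).
- by split=> //; rewrite (negPf nb).
- rewrite /mcost (@fcost_change _ (prof T s K) (prof T' s K) _ _ (mask_sub _ _ _ _) mc0).
    by rewrite pU0 !subr0 pE eqxx !ger0_norm ?addr_ge0 ?prof_ge0 //; lra.
  by move=> A; rewrite pE eq_sym => /negPf->; rewrite addr0.
- exact: contracts_card cT.
Qed.

Definition achieves T U K s t :=
  exists2 x, reachable b T U x & x <= mcost T U K s t.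

Lemma achieves_sym T U K s t : achieves T U K s t -> achieves U T K t s.
Proof.
by move=> [x /reachable_sym TU le]; exists x => //; rewrite /mcost fcostC.
Qed.

Lemma ex_relabels T e (v : R) : e \in edges T -> 0 < v ->
  exists T', relabels e v T T'.
Proof.
move=> eT v0; pose l e' := if e' == e then v else len T e'.
have lpos e' : e' \in edges T -> 0 < l e'.
  by move=> e'T; rewrite /l; case: ifP => // _; apply: len_gt0.
exists (MergeTree (treeP T) (deg_root T) (@deg_neq1 R T) lpos).
by split=> //= [|e' _ /negPf e'e]; rewrite /l ?eqxx ?e'e.
Qed.

(** With all leaves selected every edge has its own mask, so relabelling it to the entry of [U],
    positive by equality of supports, repairs one entry at its exact cost. When no bad edge is left
    the profiles agree and the trees are isomorphic. *)
Lemma achieves_same_support T U K s t :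
  mapping b T U K s t -> exhausts T K s -> exhausts U K t ->
  same_support (prof T s K) (prof U t K) -> achieves T U K s t.
Proof.
pose bad T := [fset v in nonroots T | prof T s K (mask T s K v) != prof U t K (mask T s K v)].
have in_bad T1 v : (v \in bad T1) = (v \in nonroots T1) &&
    (prof T1 s K (mask T1 s K v) != prof U t K (mask T1 s K v)).
  by rewrite !inE.
have [n] := ubnP #|` bad T|; elim: n T => // n IHn T ltn M sK tK supp.
have [K0 sS tS _] := M.
have [bad0|/fset0Pn[v]] := eqVneq (bad T) fset0.
  have pE : prof T s K =1 prof U t K.
    move=> A; have [/eqP p0|/prof_neq0P[v vN <-]] := boolP (prof T s K A == 0).
      have [A0|A0] := eqVneq A fset0; last first.
        by move: (supp A A0); rewrite p0 eqxx => /esym/eqP.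
      rewrite p0 A0; apply/esym/eqP; rewrite prof_eq0; apply/allP => u uN.
      exact: mask_neq0.
    have : v \notin bad T by rewrite bad0 in_fset0.
    by rewrite in_bad vN negbK => /eqP.
  exists 0; first exact: reachable_isom (prof_isom sS sK tS tK pE).
  rewrite /mcost /fcost !addr_ge0 ?prof_ge0 //.
  by apply: sumr_ge0 => A _; apply: normr_ge0.
rewrite in_bad => /andP[vN vbad]; have /nonrootsP[p vp] := vN.
set B := mask T s K v in vbad.
have B0 : B != fset0 by exact: mask_neq0.
have pT : prof T s K B = len T (v, p) by rewrite prof_mask // (wtE vp).
have pU0 : 0 < prof U t K B.
  rewrite lt_neqAle prof_ge0 andbT eq_sym -supp // pT gt_eqF //.
  exact: len_gt0.
have [T' rT] := ex_relabels vp pU0.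
have [_ [VE EE rE] vl lE] := rT.
have NE : nonroots T' = nonroots T by rewrite /nonroots VE rE.
have mE w : mask T' s K w = mask T s K w by rewrite /mask EE.
have leafE w : is_leaf T' w = is_leaf T w by rewrite /is_leaf VE EE.
have sS' : selection T' K s.
  by case: sS => sI sL; split=> // i iK; rewrite leafE sL.
have sK' : exhausts T' K s by move=> w; rewrite leafE => /sK.
have pB : prof T' s K B = prof U t K B.
  by rewrite /B -mE prof_mask ?NE // (@wtE _ _ _ p) ?EE // vl mE.
have pE A : A != B -> prof T' s K A = prof T s K A.
  move=> AB; rewrite /prof NE; apply: eq_big_seq => w /nonrootsP[q wq].
  rewrite mE; case: eqP => // mw; rewrite (@wtE _ T' w q) ?EE // (wtE wq) lE //.
  apply: contraNneq AB => -[wv _]; by rewrite -mw wv.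
have [|||||x rx le] := IHn T'.
- rewrite -ltnS; apply: leq_trans ltn; rewrite ltnS; apply: fproper_ltn_card.
  rewrite fproperEneq; apply/andP; split; last first.
    apply/fsubsetP => w; rewrite !in_bad NE mE => /andP[-> /=].
    have [->|wB] := eqVneq (mask T s K w) B; first by rewrite pB eqxx.
    by rewrite pE.
  apply/eqP => /fsetP/(_ v); rewrite !in_bad NE vN mE -/B pB eqxx.
  by rewrite vbad.
- split=> // bT A A0; have [->|AB] := eqVneq A B; first by rewrite pB.
  by rewrite pE // supp.
- exact: sK'.
- exact: tK.
- move=> A A0; have [->|AB] := eqVneq A B; first by rewrite pB.
  by rewrite pE // supp.
exists (`|len T (v, p) - prof U t K B| + x).
  exact: reachable_trans (reachable_relabel b rT) rx.
rewrite addrC; apply: le_trans (lerD le (lexx _)) _.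
rewrite /mcost (@fcost_change _ (prof T s K) (prof T' s K) _ B (mask_sub _ _ _ _) B0) //.
by rewrite pB subrr normr0 subr0 pT.
Qed.

(** Induction on the total number of vertices: delete unselected leaves, then contract edges whose
    masks the other tree lacks, then relabel. Moves on [U] are read backwards as insertions. *)
Lemma mapping_achieves T U K s t : mapping b T U K s t -> achieves T U K s t.
Proof.
have [n] := ubnP (#|` verts T| + #|` verts U|)%N.
elim: n T U s t => // n IHn T U s t ltn M.
have step T1 U1 s1 t1 : (#|` verts T1| + #|` verts U1| < n.+1)%N ->
    reduces T1 U1 K s1 t1 -> achieves T1 U1 K s1 t1.
  move=> lt1 [T' [x [rx M' le card]]].
  have [|y ry ley] := IHn T' U1 s1 t1 _ M'.
    by rewrite -ltnS; apply: leq_trans lt1; rewrite ltnS ltn_add2r.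
  exists (x + y); first exact: reachable_trans rx ry.
  by apply: le_trans le; rewrite addrC lerD2r.
have step' : reduces U T K t s -> achieves T U K s t.
  by move=> rU; apply/achieves_sym/step => //; rewrite addnC.
have exhaustsP T1 s1 : ~ exhausts T1 K s1 ->
    exists2 c, is_leaf T1 c & forall i, i \in K -> s1 i != c.
  move=> nex; apply: contrapT => nc; apply: nex => v lv.
  apply: contrapT => ni; apply: nc; exists v => // i iK.
  by apply/eqP => siv; apply: ni; exists i.
have [sK|/exhaustsP[c lc sc]] := pselect (exhausts T K s); last first.
  by apply: step ltn _; apply: reduces_leaf lc sc.
have [tK|/exhaustsP[c lc sc]] := pselect (exhausts U K t); last first.
  by apply: step'; apply: reduces_leaf lc sc; apply: mapping_sym.
have [supp|nsupp] := pselect (same_support (prof T s K) (prof U t K)).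
  exact: achieves_same_support.
have nb : ~~ b by case: M => _ _ _; case: b => // h; case: nsupp; apply: h.
have [A A0 nA] : exists2 A, A != fset0 & (prof T s K A == 0) != (prof U t K A == 0).
  apply: contrapT => nA; apply: nsupp => A A0.
  have [//|ne] := eqVneq (prof T s K A == 0) (prof U t K A == 0).
  by case: nA; exists A.
move: nA; case: (boolP (prof U t K A == 0)) => [/eqP U0|/prof_neq0P[c cN mc] /eqP].
  rewrite eqb_id => /prof_neq0P[c cN mc].
  by apply: step ltn _; apply: (reduces_inner nb M cN); rewrite mc.
case: eqP => // T0 _; apply: step'.
by apply: (reduces_inner nb (mapping_sym M) cN); rewrite mc.
Qed.

End Achieving.

(** * Existence of the minimum *)

Section Minimum.
Variables (R : realType) (b : bool).
Implicit Types (T U : merge_tree R) (s t : nat -> nat) (K A : {fset nat}).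

(** With one label the only nonempty mask is a singleton, where both profiles are positive; so the
    supports agree. *)
Lemma ex_mapping T U : exists K s, mapping b T U K s id.
Proof.
have [l ll _] := ex_leaf_below (root_verts T).
have [m lm _] := ex_leaf_below (root_verts U).
have sS : selection T [fset m] (fun=> l).
  by split=> [i j|i _ //]; rewrite !in_fset1 => /eqP-> /eqP->.
have tS : selection U [fset m] id.
  by split=> [i j _ _ //|i]; rewrite in_fset1 => /eqP->.
exists [fset m], (fun=> l); split=> //.
  by apply/fset0Pn; exists m; rewrite in_fset1.
move=> _ A A0; have [Am|Am] := boolP (A `<=` [fset m]); last by rewrite !prof_out.
have -> : A = [fset m] by apply/eqP; rewrite fsubset1 (negPf A0) orbF in Am.
by rewrite !gt_eqF // prof_single // in_fset1.
Qed.

Lemma prof_ext T K s s' A : {in K, s =1 s'} -> prof T s K A = prof T s' K A.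
Proof.
move=> e; apply: eq_bigr => v _; congr (if _ == _ then _ else _).
apply/fsetP => i; rewrite !in_mask.
by have [iK|//] := boolP (i \in K); rewrite e.
Qed.

Lemma mapping_ext T U K s s' : {in K, s =1 s'} ->
  mapping b T U K s id -> mapping b T U K s' id.
Proof.
move=> e [K0 [sI sL] tS supp]; split=> //.
  split=> [i j iK jK|i iK]; last by rewrite -e // sL.
  by rewrite -!e //; apply: sI.
by move=> bT A A0; rewrite -(prof_ext _ _ e) supp.
Qed.

Lemma ex_min_mapping T U : exists K s, mapping b T U K s id /\
  forall K' s', mapping b T U K' s' id -> mcost T U K s id <= mcost T U K' s' id.
Proof.
(* [K] consists of leaves of [U] and [s] matters only on [K], so mappings are coded in a finite
   type; 0 here and the root of [T] below are placeholder values. *)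
pose I := (fpowerset (verts U) * {ffun verts U -> verts T})%type.
pose s_ (g : I) i := if insub i is Some j then val (g.2 j) else 0%N.
have code K s : mapping b T U K s id ->
    exists g : I, val g.1 = K /\ {in K, s =1 s_ g}.
  move=> [_ [_ sL] [_ tL] _].
  have KU : K \in fpowerset (verts U).
    by rewrite fpowersetE; apply/fsubsetP => i /tL/andP[].
  pose g (j : verts U) : verts T := insubd [` root_verts T] (s (val j)).
  exists ([` KU], [ffun j => g j]); split=> // i iK.
  have /andP[iU _] := tL i iK; have /andP[siT _] := sL i iK.
  by rewrite /s_ (insubT (mem (verts U)) iU) /= ffunE /g val_insubd /= siT.
pose P (g : I) := `[< mapping b T U (val g.1) (s_ g) id >].
have codeP K s (g : I) : mapping b T U K s id -> val g.1 = K -> {in K, s =1 s_ g} ->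
    P g /\ mcost T U (val g.1) (s_ g) id = mcost T U K s id.
  move=> M gK gs; split; first by apply/asboolP; rewrite gK; apply: mapping_ext M.
  by rewrite /mcost gK; apply: fcost_eq => // A; rewrite (prof_ext _ _ gs).
have [K [s M]] := ex_mapping T U; have [g0 [g0K g0s]] := code _ _ M.
have [Pg0 _] := codeP _ _ _ M g0K g0s.
case: (@Order.TotalTheory.arg_minP _ _ I g0 P (fun g => mcost T U (val g.1) (s_ g) id) Pg0).
move=> g /asboolP Mg ming; exists (val g.1), (s_ g); split=> // K' s' M'.
have [g' [g'K g's]] := code _ _ M'.
by have [Pg' <-] := codeP _ _ _ M' g'K g's; apply: ming.
Qed.

Lemma ex_min_reachable T U : exists x, is_min (reachable b T U) x.
Proof.
have [K [s [M minM]]] := ex_min_mapping T U.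
have [x rx le] := mapping_achieves M; exists x; split=> // y.
move=> /reachable_bounded[K' [s' [M' le']]].
exact: le_trans le (le_trans (minM _ _ M') le').
Qed.

Lemma set_min_metric : is_metric_up_to_isom (fun T U => set_min (reachable b T U)).
Proof.
(* The minimum exists, so [set_min] never falls back to 0 and the axioms reduce to properties of
   [reachable]. *)
have minP T U : is_min (reachable b T U) (set_min (reachable b T U)).
  rewrite /set_min; case: xgetP => [x -> //|].
  by have [x mx] := ex_min_reachable T U => /(_ x).
have minR T U := (minP T U).1.
have minL T U x (r : reachable b T U x) := (minP T U).2 x r.
split=> [T1 T1' T2 T2' i1 i2|T U|T U|T U|T1 T2 T3].
- apply: le_anti; apply/andP; split; apply: minL.
    by apply: reachable_isoml i1 (reachable_isomr (isom_sym i2) _).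
  by apply: reachable_isoml (isom_sym i1) (reachable_isomr i2 _).
- exact: reachable_ge0 (minR T U).
- split=> [d0|TU]; first by apply: (@reachable0 _ b); rewrite -d0.
  apply: le_anti; rewrite (reachable_ge0 (minR T U)) andbT.
  exact/minL/reachable_isom.
- by apply: le_anti; apply/andP; split; apply/minL/reachable_sym.
- exact/minL/reachable_trans.
Qed.

End Minimum.

Theorem theorem2 (R : realType) :
  is_metric_up_to_isom (@delta_E R) /\ is_metric_up_to_isom (@delta_1 R).
Proof.
split.
- suff -> : @delta_E R = fun T U => set_min (reachable false T U).
    exact: set_min_metric.
  apply/funext => T; apply/funext => U; congr set_min.
  apply/funext => x; apply/propext; split=> [[S tS cS]|[S [tS _ cS]]].
    by exists S.
  by exists S.
- suff -> : @delta_1 R = fun T U => set_min (reachable true T U).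
    exact: set_min_metric.
  apply/funext => T; apply/funext => U; congr set_min.
  apply/funext => x; apply/propext; split=> [[S [tS oS] cS]|[S [tS oS cS]]].
    by exists S.
  by exists S => //; split=> //; apply: oS.
Qed.
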